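(* Let $X$ be a topological space and let $\mathcal{U}$ be a complete open cover of $X$, regarded as a partially ordered set under inclusion and thereby as a category. Then the natural map $$\mathrm{hocolim}_{U\in\mathcal{U}}\,U\to X$$ is a weak homotopy equivalence.
   Context: An open cover $\mathcal{U}$ of $X$ is complete if, for every finite subset $\mathcal{U}_0\subseteq\mathcal{U}$, the cover $\mathcal{U}$ contains an open cover of $\bigcap_{U\in\mathcal{U}_0}U$ (i.e., this intersection is a union of members of $\mathcal{U}$). The homotopy colimit is that of the tautological functor $\mathcal{U}\to\mathrm{Top}$, $U\mapsto U$. For a functor $F:I\to\mathrm{Top}$ from a small category it may be modeled by the geometric realization of the simplicial space $\mathrm{Bar}_\bullet(F)$ with $\mathrm{Bar}_n(F)=\coprod_{i_n\to\cdots\to i_0}F(i_n)$ and face and degeneracy maps given by composition (including application of $F$) and insertion of identities; the natural map to $X$ is the composite $|\mathrm{Bar}_\bullet(F)|\to\mathrm{colim}_{U\in\mathcal U}U\to X$ induced by the inclusions $U\subseteq X$. *)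

(* Defs.v *)
From HB Require Import structures.
From mathcomp Require Import all_boot all_order all_algebra generic_quotient.
From mathcomp Require Import all_classical all_reals topology homotopy.
From mathcomp Require Import unstable normedtype.
From Stdlib Require Import Relation_Operators.

Set Implicit Arguments.
Unset Strict Implicit.
Unset Printing Implicit Defensive.

Import Order.TTheory GRing.Theory Num.Theory.
Import numFieldNormedType.Exports.

Local Open Scope classical_set_scope.
Local Open Scope ring_scope.
Local Open Scope quotient_scope.

Section GlueSpace.
Context {T : topologicalType} (r : T -> T -> Prop).

Let glue_rel : rel T := fun x y => `[< clos_refl_sym_trans T r x y >].

Local Lemma glue_rel_refl : reflexive glue_rel.
Proof. by move=> x; apply/asboolP; exact: rst_refl. Qed.

Local Lemma glue_rel_sym : symmetric glue_rel.
Proof.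
by move=> x y; apply/idP/idP => /asboolP xy; apply/asboolP; exact: rst_sym.
Qed.

Local Lemma glue_rel_trans : transitive glue_rel.
Proof.
by move=> y x z /asboolP xy /asboolP yz; apply/asboolP; exact: rst_trans yz.
Qed.

Definition glue_equiv := EquivRel _ glue_rel_refl glue_rel_sym glue_rel_trans.

(* The quotient of T by the equivalence relation generated by r. *)
Definition glue_space := {eq_quot glue_equiv}.
HB.instance Definition _ :=
  Topological.copy glue_space (quotient_topology glue_space).
HB.instance Definition _ := Quotient.on glue_space.

Lemma glue_space_eqP (x y : T) :
  \pi_glue_space x = \pi_glue_space y <-> clos_refl_sym_trans T r x y.
Proof. by split=> [/eqmodP/asboolP|xy]//; apply/eqmodP/asboolP. Qed.

Section lift.
Context {Z : topologicalType} (g : T -> Z).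
Hypotheses (g_cts : continuous g) (g_r : forall x y, r x y -> g x = g y).

Definition glue_lift : glue_space -> Z :=
  let _ := (g_cts, g_r) in fun q => g (repr q).

Lemma glue_liftE x : glue_lift (\pi_glue_space x) = g x.
Proof.
have g_eq a b : clos_refl_sym_trans T r a b -> g a = g b.
  by elim=> [u v /g_r|||u v w _ -> _ ->].
by apply/g_eq/glue_space_eqP; rewrite reprK.
Qed.

Lemma glue_lift_continuous : continuous glue_lift.
Proof.
apply/(@quotient_continuous T glue_space Z).
rewrite (_ : _ \o _ = g)//; apply/funext => x; exact: glue_liftE.
Qed.

HB.instance Definition _ :=
  @isContinuous.Build glue_space Z glue_lift glue_lift_continuous.
End lift.

End GlueSpace.

Record simp_op (m n : nat) := SimpOp {
  simp_fun :> 'I_m.+1 -> 'I_n.+1;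
  simp_homo : {homo simp_fun : i j / (i <= j)%N} }.

Definition simp_id n : simp_op n n :=
  @SimpOp n n (fun i => i) (fun i j ij => ij).

Definition simp_comp m n p (g : simp_op n p) (f : simp_op m n) : simp_op m p :=
  @SimpOp m p (fun i => g (f i)) (fun i j ij => simp_homo g (simp_homo f ij)).

Record simplicialSpace := SimplicialSpace {
  simp_obj :> nat -> topologicalType;
  simp_act : forall m n, simp_op m n -> continuousType (simp_obj n) (simp_obj m);
  simp_act_id : forall n (x : simp_obj n), simp_act (simp_id n) x = x;
  simp_act_comp : forall m n p (g : simp_op n p) (f : simp_op m n)
    (x : simp_obj p), simp_act (simp_comp g f) x = simp_act f (simp_act g x) }.

Section Realization.
Context (R : realType).

(* Barycentric coordinates. *)
Definition std_simplex n : set 'rV[R]_n.+1 :=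
  [set t | (forall i, 0 <= t 0 i) /\ \sum_i t 0 i = 1].
Arguments std_simplex : clear implicits.

Lemma std_simplex_push_subproof m n (f : simp_op m n) (t : std_simplex m) :
  (\row_j \sum_(i | f i == j) (val t) 0 i) \in std_simplex n.
Proof.
apply/mem_set; have [t_ge0 t_sum1] := set_valP t; split=> [j|].
  by rewrite mxE; apply: sumr_ge0.
under eq_bigr do rewrite mxE.
by rewrite -t_sum1 [RHS](partition_big f predT).
Qed.

Definition std_simplex_push m n (f : simp_op m n) (t : std_simplex m) :
  std_simplex n := SigSub (std_simplex_push_subproof f t).

Context (S : simplicialSpace).

Variant realization_rel : {n & S n * std_simplex n}%type ->
    {n & S n * std_simplex n}%type -> Prop :=
  | RealizationRel m n (f : simp_op m n) (x : S n) (t : std_simplex m) :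
      realization_rel (existT _ m (simp_act S f x, t))
                      (existT _ n (x, std_simplex_push f t)).

Definition realization := glue_space realization_rel.
HB.instance Definition _ := Topological.on realization.
HB.instance Definition _ := Quotient.on realization.

End Realization.

Arguments std_simplex : clear implicits.

Record smallCategory := SmallCategory {
  cat_obj :> choiceType;
  cat_hom : cat_obj -> cat_obj -> Type;
  cat_id : forall a, cat_hom a a;
  cat_comp : forall a b c, cat_hom b c -> cat_hom a b -> cat_hom a c;
  cat_comp1f : forall a b (f : cat_hom a b), cat_comp (cat_id b) f = f;
  cat_compf1 : forall a b (f : cat_hom a b), cat_comp f (cat_id a) = f;
  cat_compA : forall a b c d (h : cat_hom c d) (g : cat_hom b c)
    (f : cat_hom a b),
    cat_comp h (cat_comp g f) = cat_comp (cat_comp h g) f }.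

Record topFunctor (C : smallCategory) := TopFunctor {
  fun_obj :> C -> topologicalType;
  fun_mor : forall a b : C,
    cat_hom a b -> continuousType (fun_obj a) (fun_obj b);
  fun_mor_id : forall (a : C) (x : fun_obj a), fun_mor (cat_id a) x = x;
  fun_mor_comp : forall (a b c : C) (g : cat_hom b c) (f : cat_hom a b)
    (x : fun_obj a), fun_mor (cat_comp g f) x = fun_mor g (fun_mor f x) }.

Section Bar.
Context (C : smallCategory).

(* A string i_n -> ... -> i_0 of composable arrows, recorded together with all
   its composites i_k -> i_j for j <= k: a functor from the opposite of the
   ordinal [0 < ... < n] to C. In this form face maps (which compose two
   consecutive arrows or drop an end of the string) and degeneracy maps (which
   insert an identity) are restrictions along the maps of ordinals. *)
Record cat_string (n : nat) := CatString {
  str_obj :> 'I_n.+1 -> C;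
  str_arr : forall j k : 'I_n.+1, (j <= k)%N -> cat_hom (str_obj k) (str_obj j);
  str_arr_id : forall (j : 'I_n.+1) (jj : (j <= j)%N),
    str_arr jj = cat_id (str_obj j);
  str_arr_comp : forall (i j k : 'I_n.+1) (ij : (i <= j)%N) (jk : (j <= k)%N)
    (ik : (i <= k)%N), str_arr ik = cat_comp (str_arr ij) (str_arr jk) }.

HB.instance Definition _ n := gen_eqMixin (cat_string n).
HB.instance Definition _ n := gen_choiceMixin (cat_string n).

Definition str_pull m n (f : simp_op m n) (s : cat_string n) : cat_string m :=
  @CatString m (fun i => s (f i))
    (fun j k jk => str_arr s (simp_homo f jk))
    (fun j jj => str_arr_id s (simp_homo f jj))
    (fun i j k ij jk ik => str_arr_comp s
       (simp_homo f ij) (simp_homo f jk) (simp_homo f ik)).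

Context (F : topFunctor C).

Definition bar_obj n : topologicalType := {s : cat_string n & F (s ord_max)}.

Definition bar_act_fun m n (f : simp_op m n) : bar_obj n -> bar_obj m :=
  sigT_fun (fun s x => existT (fun s' : cat_string m => F (s' ord_max))
    (str_pull f s) (fun_mor F (@str_arr n s (f ord_max) ord_max (leq_ord _)) x)).

Lemma bar_act_fun_continuous m n (f : simp_op m n) :
  continuous (bar_act_fun f).
Proof.
apply: sigT_continuous => s x; apply: continuous_comp; first exact: cts_fun.
exact: existT_continuous.
Qed.

HB.instance Definition _ m n (f : simp_op m n) :=
  @isContinuous.Build _ _ (bar_act_fun f) (@bar_act_fun_continuous m n f).

Definition bar_act m n (f : simp_op m n) :
  continuousType (bar_obj n) (bar_obj m) := bar_act_fun f.

Lemma bar_act_id n (x : bar_obj n) : bar_act (simp_id n) x = x.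
Proof.
case: x => -[o a i c] x.
transitivity (existT (fun s : cat_string n => F (s ord_max)) (CatString i c)
  (fun_mor F (a ord_max ord_max (leq_ord ord_max)) x)); first by [].
by rewrite i fun_mor_id.
Qed.

Lemma bar_act_comp m n p (g : simp_op n p) (f : simp_op m n) (x : bar_obj p) :
  bar_act (simp_comp g f) x = bar_act f (bar_act g x).
Proof.
case: x => s x.
transitivity (existT (fun s' : cat_string m => F (s' ord_max))
  (str_pull (simp_comp g f) s) (fun_mor F
    (cat_comp (@str_arr n (str_pull g s) (f ord_max) ord_max (leq_ord _))
              (@str_arr p s (g ord_max) ord_max (leq_ord _))) x)).
  pose ext h := existT (fun s' : cat_string m => F (s' ord_max))
    (str_pull (simp_comp g f) s) (fun_mor F h x).
  exact: (congr1 ext (str_arr_comp s _ _ _)).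
by rewrite fun_mor_comp.
Qed.

Definition bar : simplicialSpace := SimplicialSpace bar_act_id bar_act_comp.

Variant colim_rel : {i : C & F i} -> {i : C & F i} -> Prop :=
  | ColimRel (a b : C) (h : cat_hom a b) (x : F a) :
      colim_rel (existT _ a x) (existT _ b (fun_mor F h x)).

Definition colim := glue_space colim_rel.
HB.instance Definition _ := Topological.on colim.
HB.instance Definition _ := Quotient.on colim.

Section colim_desc.
Context {Z : topologicalType} (g : forall i, continuousType (F i) Z).
Hypothesis g_nat : forall a b (h : cat_hom a b) x, g b (fun_mor F h x) = g a x.

Local Lemma colim_desc_cts : continuous (sigT_fun g).
Proof. by apply: sigT_continuous => i; exact: cts_fun. Qed.

Local Lemma colim_desc_rel x y : colim_rel x y -> sigT_fun g x = sigT_fun g y.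
Proof. by case=> a b h {}x; exact/esym/g_nat. Qed.

Definition colim_desc : continuousType colim Z :=
  glue_lift colim_desc_cts colim_desc_rel.
End colim_desc.

Context (R : realType).

Definition hocolim := realization R bar.
HB.instance Definition _ := Topological.on hocolim.
HB.instance Definition _ := Quotient.on hocolim.

(* The class of ((i_n -> ... -> i_0, x), t) with x in F(i_n) goes to the class
   of x. *)
Definition hocolim_to_colim_pre (y : {n & bar n * std_simplex R n}%type) :
    colim :=
  let: existT _ (existT s x, _) := y in
  \pi_colim (existT (fun i => F i) (s ord_max) x).

Local Lemma hocolim_to_colim_cts : continuous hocolim_to_colim_pre.
Proof.
pose g n : bar n -> colim := sigT_fun (fun (s : cat_string n) x =>
  \pi_colim (existT (fun i => F i) (s ord_max) x)).
have g_cts n : continuous (g n).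
  apply: sigT_continuous => s x; apply: continuous_comp.
    exact: existT_continuous.
  exact: (@pi_continuous _ colim).
rewrite (_ : hocolim_to_colim_pre =
  sigT_fun (fun n (y : bar n * std_simplex R n) => g n y.1)); last first.
  by apply/funext => -[n [[s x] t]].
apply: sigT_continuous => n y; apply: continuous_comp; first exact: cvg_fst.
exact: g_cts.
Qed.

Local Lemma hocolim_to_colim_rel x y : realization_rel x y ->
  hocolim_to_colim_pre x = hocolim_to_colim_pre y.
Proof.
case=> m n f [s {}x] t /=; apply/esym/glue_space_eqP/rst_step.
exact: ColimRel.
Qed.

Definition hocolim_to_colim : continuousType hocolim colim :=
  glue_lift hocolim_to_colim_cts hocolim_to_colim_rel.

End Bar.

Section Homotopy.
Context (R : realType).

Definition unit_interval : set R := `[0, 1].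

Lemma unit_interval0 : 0 \in unit_interval.
Proof. by apply/mem_set; rewrite /unit_interval/= in_itv/= lexx ler01. Qed.

Lemma unit_interval1 : 1 \in unit_interval.
Proof. by apply/mem_set; rewrite /unit_interval/= in_itv/= lexx ler01. Qed.

Definition I0 : unit_interval := SigSub unit_interval0.
Definition I1 : unit_interval := SigSub unit_interval1.

Definition homotopic_rel {T X : topologicalType} (A : set T) (a b : T -> X) :=
  exists H : T * unit_interval -> X,
    [/\ continuous H, forall t, H (t, I0) = a t, forall t, H (t, I1) = b t &
        forall t s, A t -> H (t, s) = a t].

Section homotopic_equiv.
Context {T X : topologicalType} (A : set T).

Lemma homotopic_refl (a : T -> X) : continuous a -> homotopic_rel A a a.
Proof.
move=> a_cts; exists (a \o fst); split=> // t.
by apply: continuous_comp; [exact: cvg_fst|exact: a_cts].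
Qed.

Definition clamp01 (x : R) := Num.max 0 (Num.min 1 x).

Lemma clamp01_subproof x : clamp01 x \in unit_interval.
Proof.
apply/mem_set; rewrite /unit_interval/= in_itv/= /clamp01.
by rewrite le_max lexx/= ge_max ler01 ge_min lexx.
Qed.

Definition to_unit x : unit_interval := SigSub (clamp01_subproof x).

Lemma to_unit_continuous : continuous to_unit.
Proof.
apply: continuous_comp_initial => x.
apply: (@continuous_comp _ _ _ (fun y : R => Num.min 1 y) (Num.max 0)).
  by apply: continuous_min; [exact: cvg_cst|exact: cvg_id].
by apply: continuous_max; [exact: cvg_cst|exact: cvg_id].
Qed.

Lemma to_unit_val (s : unit_interval) : to_unit (val s) = s.
Proof.
apply/val_inj; rewrite /= /clamp01.
have := set_valP s; rewrite /unit_interval/= in_itv/= => /andP[s0 s1].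
by rewrite (min_idPr s1) (max_idPr s0).
Qed.

Lemma to_unit_le0 (x : R) : x <= 0 -> to_unit x = I0.
Proof.
move=> x0; apply/val_inj; rewrite /= /clamp01.
by rewrite (min_idPr (le_trans x0 ler01)) (max_idPl x0).
Qed.

Lemma to_unit_ge1 (x : R) : 1 <= x -> to_unit x = I1.
Proof.
by move=> x1; apply/val_inj; rewrite /= /clamp01 (min_idPl x1) (max_idPr ler01).
Qed.

Let reparam (f : R -> R) (t : T * unit_interval) : T * unit_interval :=
  (t.1, to_unit (f (val t.2))).

Lemma reparam_continuous f : continuous f -> continuous (reparam f).
Proof.
move=> f_cts; have g_cts : continuous
    (fun u : T * unit_interval => to_unit (f (val u.2))).
  move=> t; apply: (@continuous_comp _ _ _
    (fun u : T * unit_interval => f (val u.2)) to_unit);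
    last exact: to_unit_continuous.
  apply: (@continuous_comp _ _ _ (fun u : T * unit_interval => val u.2) f);
    last exact: f_cts.
  apply: (@continuous_comp _ _ _ (@snd T unit_interval) val);
    first exact: cvg_snd.
  exact: initial_continuous.
move=> t.
exact: (@cvg_pair _ _ _ (nbhs t) (nbhs t.1) (nbhs (to_unit (f (val t.2)))) _ _ _
  fst (fun u => to_unit (f (val u.2))) cvg_fst (g_cts t)).
Qed.

Lemma homotopic_sym (a b : T -> X) : homotopic_rel A a b -> homotopic_rel A b a.
Proof.
move=> [H [H_cts H0 H1 HA]].
exists (H \o reparam (fun x => 1 - x)); split=> [t|t|t|t s At] /=.
- apply: continuous_comp; last exact: H_cts.
  by apply: reparam_continuous => x; apply: cvgB; [exact: cvg_cst|exact: cvg_id].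
- by rewrite /reparam /= subr0 to_unit_ge1.
- by rewrite /reparam /= subrr to_unit_le0.
- by rewrite /reparam /= HA// -H1 HA.
Qed.

Lemma homotopic_trans (a b c : T -> X) :
  homotopic_rel A a b -> homotopic_rel A b c -> homotopic_rel A a c.
Proof.
move=> [H [H_cts H0 H1 HA]] [K [K_cts K0 K1 KA]].
pose H' := H \o reparam (fun x => 2 * x).
pose K' := K \o reparam (fun x => 2 * x - 1).
have H'_cts : continuous H'.
  move=> t; apply: continuous_comp; last exact: H_cts.
  by apply: reparam_continuous => x; apply: cvgM; [exact: cvg_cst|exact: cvg_id].
have K'_cts : continuous K'.
  move=> t; apply: continuous_comp; last exact: K_cts.
  apply: reparam_continuous => x; apply: cvgB; last exact: cvg_cst.
  by apply: cvgM; [exact: cvg_cst|exact: cvg_id].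
have valsnd_cts : continuous (fun t : T * unit_interval => val t.2).
  move=> t; apply: (@continuous_comp _ _ _ (@snd T unit_interval) val).
    exact: cvg_snd.
  exact: initial_continuous.
pose L t := if val t.2 <= 2^-1 then H' t else K' t.
have L_le t : val t.2 <= 2^-1 -> L t = H' t by rewrite /L => ->.
have L_ge t : 2^-1 <= val t.2 -> L t = K' t.
  rewrite /L le_eqVlt => /predU1P[e|]; last by rewrite ltNge => /negbTE ->.
  rewrite -e lexx /H' /K' /= /reparam -e mulfV ?pnatr_eq0// subrr.
  by rewrite to_unit_ge1// to_unit_le0// H1 K0.
exists L; split=> [|t|t|t s At].
- pose B := [set t : T * unit_interval | val t.2 <= 2^-1].
  pose C := [set t : T * unit_interval | 2^-1 <= val t.2].
  have BC : B `|` C = setT.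
    by apply/seteqP; split=> // t _; rewrite /B /C/=; case: (leP (val t.2) 2^-1);
      [left|right; exact: ltW].
  apply/continuous_subspace_setT; rewrite -BC; apply: withinU_continuous.
  + apply: (@preimage_closed _ _ (fun t : T * unit_interval => val t.2)
      [set x : R | x <= 2^-1]); last exact: closed_le.
    by move=> t _; exact: valsnd_cts.
  + apply: (@preimage_closed _ _ (fun t : T * unit_interval => val t.2)
      [set x : R | 2^-1 <= x]); last exact: closed_ge.
    by move=> t _; exact: valsnd_cts.
  + apply: (@subspace_eq_continuous _ B _ H'); last exact: continuous_subspaceT.
    by move=> t /set_mem/= /L_le e; exact: esym e.
  + apply: (@subspace_eq_continuous _ C _ K'); last exact: continuous_subspaceT.
    by move=> t /set_mem/= /L_ge e; exact: esym e.
- by rewrite L_le ?invr_ge0//= /H' /= /reparam /= mulr0 to_unit_le0.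
- rewrite L_ge/= ?invf_le1// ?ler1n//.
  by rewrite /K' /= /reparam /= mulr1 to_unit_ge1// addrK.
- rewrite /L; case: ifP => _; rewrite /H' /K' /= /reparam /=; first exact: HA.
  by rewrite KA// -H1 HA.
Qed.

End homotopic_equiv.

Lemma homotopic_comp {T X Y : topologicalType} (A : set T) (a b : T -> X)
    (f : X -> Y) :
  continuous f -> homotopic_rel A a b -> homotopic_rel A (f \o a) (f \o b).
Proof.
move=> f_cts [H [H_cts H0 H1 HA]]; exists (f \o H); split=> [t|t|t|t s At] /=.
- by apply: continuous_comp; [exact: H_cts|exact: f_cts].
- by rewrite H0.
- by rewrite H1.
- by rewrite HA.
Qed.

Definition path_connected {X : topologicalType} (x y : X) :=
  exists g : unit_interval -> X, [/\ continuous g, g I0 = x & g I1 = y].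

Lemma path_homotopicP {X : topologicalType} (x y : X) :
  path_connected x y <->
  homotopic_rel (set0 : set unit_interval) (cst x) (cst y).
Proof.
split=> [[g [g_cts g0 g1]]|[H [H_cts H0 H1 _]]].
  exists (g \o snd); split=> // t.
  by apply: continuous_comp; [exact: cvg_snd|exact: g_cts].
exists (fun s => H (I0, s)); split=> // s.
apply: (@continuous_comp _ _ _ (fun s => (I0, s)) H); last exact: H_cts.
exact: (@cvg_pair _ _ _ (nbhs s) (nbhs I0) (nbhs s) _ _ _ (cst I0) id
  (@cvg_cst _ I0 _ _ _) cvg_id).
Qed.

Section pi0.
Context (X : topologicalType).

Let path_rel : rel X := fun x y => `[< path_connected x y >].

Local Lemma path_rel_refl : reflexive path_rel.
Proof.
by move=> x; apply/asboolP/path_homotopicP/homotopic_refl; exact: cst_continuous.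
Qed.

Local Lemma path_rel_sym : symmetric path_rel.
Proof.
by move=> x y; apply/idP/idP => /asboolP/path_homotopicP xy;
  apply/asboolP/path_homotopicP/homotopic_sym.
Qed.

Local Lemma path_rel_trans : transitive path_rel.
Proof.
move=> y x z /asboolP/path_homotopicP xy /asboolP/path_homotopicP yz.
exact/asboolP/path_homotopicP/(homotopic_trans xy).
Qed.

Definition path_equiv := EquivRel _ path_rel_refl path_rel_sym path_rel_trans.

Definition pi0 := {eq_quot path_equiv}.
HB.instance Definition _ := Quotient.on pi0.

Lemma pi0_eqP (x y : X) : \pi_pi0 x = \pi_pi0 y <-> path_connected x y.
Proof. by split=> [/eqmodP/asboolP|xy]//; apply/eqmodP/asboolP. Qed.

End pi0.

Definition pi0_map {X Y : topologicalType} (f : continuousType X Y) :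
  pi0 X -> pi0 Y := fun c => \pi_(pi0 Y) (f (repr c)).

Lemma pi0_mapE {X Y : topologicalType} (f : continuousType X Y) (x : X) :
  pi0_map f (\pi_(pi0 X) x) = \pi_(pi0 Y) (f x).
Proof.
apply/pi0_eqP/path_homotopicP.
apply: (@homotopic_comp _ _ _ _ (cst _) (cst _)); first exact: cts_fun.
by apply/path_homotopicP/pi0_eqP; rewrite reprK.
Qed.

Definition cube n : set 'rV[R]_n := [set t | forall i, 0 <= t 0 i <= 1].
Arguments cube : clear implicits.

Definition cube_boundary n : set (cube n) :=
  [set t : cube n | exists i, val t 0 i = 0 \/ val t 0 i = 1].
Arguments cube_boundary : clear implicits.

Section pin.
Context (n : nat) (X : topologicalType) (x : X).

Definition spheroid : set (continuousType (cube n) X) :=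
  [set a | forall t, cube_boundary n t -> a t = x].

Let sph_rel : rel spheroid :=
  fun a b => `[< homotopic_rel (cube_boundary n) (val a) (val b) >].

Local Lemma sph_rel_refl : reflexive sph_rel.
Proof. by move=> a; apply/asboolP/homotopic_refl; exact: cts_fun. Qed.

Local Lemma sph_rel_sym : symmetric sph_rel.
Proof.
by move=> a b; apply/idP/idP => /asboolP ab; apply/asboolP/homotopic_sym.
Qed.

Local Lemma sph_rel_trans : transitive sph_rel.
Proof.
move=> b a c /asboolP ab /asboolP bc.
exact/asboolP/(homotopic_trans ab).
Qed.

Definition sph_equiv := EquivRel _ sph_rel_refl sph_rel_sym sph_rel_trans.

(* The underlying set of the n-th homotopy group of X at x. *)
Definition pin := {eq_quot sph_equiv}.
HB.instance Definition _ := Quotient.on pin.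

Lemma pin_eqP (a b : spheroid) : \pi_pin a = \pi_pin b <->
  homotopic_rel (cube_boundary n) (val a) (val b).
Proof. by split=> [/eqmodP/asboolP|ab]//; apply/eqmodP/asboolP. Qed.

End pin.

Arguments spheroid n {X} x.


Section pin_map.
Context (n : nat) (X Y : topologicalType) (f : continuousType X Y) (x : X).

Lemma spheroid_comp_subproof (a : spheroid n x) :
  [the continuousType (cube n) Y of f \o val a] \in spheroid n (f x).
Proof. by apply/mem_set => t /= /(set_valP a) ->. Qed.

Definition spheroid_comp (a : spheroid n x) : spheroid n (f x) :=
  SigSub (spheroid_comp_subproof a).

Definition pin_map : pin n x -> pin n (f x) :=
  fun c => \pi_(pin n (f x)) (spheroid_comp (repr c)).

Lemma pin_mapE (a : spheroid n x) :
  pin_map (\pi_(pin n x) a) = \pi_(pin n (f x)) (spheroid_comp a).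
Proof.
apply/pin_eqP/homotopic_comp; first exact: cts_fun.
by apply/pin_eqP; rewrite reprK.
Qed.

End pin_map.

(* Being induced by f, the maps on homotopy groups are group homomorphisms, so
   that they are isomorphisms if and only if they are bijective. *)
Definition weak_homotopy_equivalence {X Y : topologicalType}
    (f : continuousType X Y) :=
  bijective (pi0_map f) /\
  forall (n : nat) (x : X), (0 < n)%N -> bijective (@pin_map n X Y f x).

End Homotopy.

Section Cover.
Context {X : topologicalType} (U : set (set X)).

Definition complete_open_cover :=
  [/\ forall A, U A -> open A, \bigcup_(A in U) A = setT &
      forall U0 : set (set X), U0 `<=` U -> finite_set U0 ->
        exists2 V : set (set X), V `<=` U &
          \bigcup_(A in V) A = \bigcap_(A in U0) A].

(* U ordered by inclusion: there is one arrow A -> B when A is included in B,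
   and none otherwise. *)
Definition cover_category : smallCategory :=
  @SmallCategory U (fun A B : U => (val A `<=` val B : Prop))
    (fun A => @subset_refl _ (val A))
    (fun A B C BC AB => subset_trans AB BC)
    (fun A B f => Prop_irrelevance _ _)
    (fun A B f => Prop_irrelevance _ _)
    (fun A B C D h g f => Prop_irrelevance _ _).

Lemma subfun_continuous (A B : set X) (AB : A `<=` B) :
  continuous (subfun AB : A -> B).
Proof.
apply: continuous_comp_initial.
rewrite (_ : _ \o _ = set_val)//; exact: initial_continuous.
Qed.

HB.instance Definition _ (A B : set X) (AB : A `<=` B) :=
  @isContinuous.Build A B (subfun AB) (@subfun_continuous A B AB).

(* The tautological functor. *)
Definition cover_functor : topFunctor cover_category :=
  @TopFunctor cover_category (fun A : U => set_type (val A : set X) : topologicalType)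
    (fun (A B : U) (AB : val A `<=` val B) => subfun AB)
    (fun (A : U) (x : (val A : set X)) =>
       val_inj (erefl : val (subfun (@subset_refl _ (val A)) x) = val x))
    (fun (A B C : U) (g : val B `<=` val C) (f : val A `<=` val B)
       (x : (val A : set X)) =>
       val_inj (erefl : val (subfun (subset_trans f g) x) =
                        val (subfun g (subfun f x)))).

HB.instance Definition _ (A : set X) :=
  @isContinuous.Build A X set_val (@initial_continuous A X set_val).

Definition colim_to_space : continuousType (colim cover_functor) X :=
  @colim_desc _ cover_functor X (fun A : U => @set_val X (val A))
    (fun A B h x => erefl).

Definition hocolim_to_space (R : realType) :
    continuousType (hocolim cover_functor R) X :=
  colim_to_space \o hocolim_to_colim cover_functor R.

Lemma hocolim_to_spaceE (R : realType) n (s : cat_string cover_category n)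
    (x : cover_functor (s ord_max)) (t : std_simplex R n) :
  hocolim_to_space R (\pi_(hocolim cover_functor R)
    (existT (fun n => bar cover_functor n * std_simplex R n)%type n
       (existT (fun s : cat_string cover_category n => cover_functor (s ord_max))
         s x, t))) = set_val x.
Proof.
rewrite /hocolim_to_space /= /hocolim_to_colim glue_liftE /=.
by rewrite /colim_to_space /colim_desc glue_liftE.
Qed.

End Cover.

(* Main.v *)
Require Import Defs.
From HB Require Import structures.
From mathcomp Require Import all_boot all_order all_algebra generic_quotient.
From mathcomp Require Import all_classical all_reals topology normedtype.
From mathcomp Require Import unstable ring lra.
From Stdlib Require Import Relation_Operators.

(* A point e of the homotopy colimit is determined by its image in X and by its
   barycentric coordinates, a function on U whose support is a finite chain of
   sets containing that image.

   Completeness says that the members of U containing a given point are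
   downward directed.  Slicing the cube along its last coordinate, this yields
   by induction on the dimension that every map f from a cube to X lifts to
   the homotopy colimit, and that the lift may be chosen below finitely many
   prescribed sets: if C is closed and f(C) is contained in V, then the
   members of U used by the lift over C are contained in V.

   Now let a lift g be given near the boundary of the cube.  Cutting off its small
   coordinates makes their supports closed; a lift r of f that lies below
   these supports then forms a chain with g at every point, and g can be
   joined linearly to r.  So lifts over a collar extend to the cube, and this
   gives both the surjectivity and the injectivity on homotopy groups. *)

Set Implicit Arguments.
Unset Strict Implicit.
Unset Printing Implicit Defensive.

Import Order.TTheory GRing.Theory Num.Theory.
Import numFieldNormedType.Exports.

Local Open Scope classical_set_scope.
Local Open Scope ring_scope.
Local Open Scope quotient_scope.

(** * Topological preliminaries *)

(** The obstacle is that two lifts of the same map cannot in general be averaged: a set used by one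
    and a set used by the other need not be comparable, so their joint support need not be a chain.
    Averaging becomes possible as soon as one lift lies below the other, and a third lift below two
    given ones can be averaged with each of them. This is why lifting is proved together with
    prescribed upper bounds: the same clause joins lifts over adjacent slabs and attaches a lift to
    boundary data. The cut-off level has to be continuous on the realization and strictly below the
    largest coordinate. Half the sum of the squares of the coordinates does this: the sum is a
    weighted mean of the coordinates, so it is positive and at most their maximum. Joining to the
    boundary data takes room, whereas a spheroid or a homotopy is prescribed on the boundary only. A
    self-map of the cube that crushes a collar into the boundary, homotopic to the identity,
    provides the room. *)

Lemma continuous_comp_fun {S T V : topologicalType} (f : S -> T) (g : T -> V) :
  continuous f -> continuous g -> continuous (fun x => g (f x)).
Proof. by move=> cf cg x; apply: continuous_comp; [exact: cf|exact: cg]. Qed.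

Lemma continuous_pair {S T V : topologicalType} (f : S -> T) (g : S -> V) :
  continuous f -> continuous g -> continuous (fun x => (f x, g x)).
Proof.
move=> cf cg x.
exact: (@cvg_pair _ _ _ (nbhs x) (nbhs (f x)) (nbhs (g x)) _ _ _ f g (cf x) (cg x)).
Qed.

Lemma continuous_fst {S T : topologicalType} : continuous (@fst S T).
Proof. by move=> x; exact: cvg_fst. Qed.

Lemma continuous_snd {S T : topologicalType} : continuous (@snd S T).
Proof. by move=> x; exact: cvg_snd. Qed.

Lemma continuous_subtype {S T : topologicalType} (A : set T) (f : S -> A) :
  continuous (fun x => val (f x)) -> continuous f.
Proof. by move=> cf; apply: continuous_comp_initial; exact: cf. Qed.

Lemma continuous_val {T : topologicalType} (A : set T) :
  continuous (fun x : A => val x).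
Proof. exact: initial_continuous. Qed.

Lemma mx_continuous {S T : topologicalType} m n (f : S -> 'M[T]_(m, n)) :
  (forall i j, continuous (fun x => f x i j)) -> continuous f.
Proof.
move=> cf x A [P fP PA].
have : \forall y \near x, forall i j, P i j (f y i j).
  apply: filter_forall => i; apply: filter_forall => j; exact/cf/fP.
by apply: filterS => y Py; exact: PA.
Qed.

Lemma near_in {T : Type} {I : eqType} (F : set_system T) (s : seq I)
    (P : I -> T -> Prop) : Filter F ->
  {in s, forall i, \near F, P i F} -> \near F, {in s, forall i, P i F}.
Proof.
move=> FF; elim: s => [|i s IHs] Ps; first by apply: nearW.
have Pi := Ps i (mem_head _ _).
have /IHs IH : {in s, forall i, \near F, P i F}.
  by move=> j js; apply: Ps; rewrite in_cons js orbT.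
apply: filterS2 Pi IH => x Pix Psx j; rewrite in_cons => /predU1P[->//|].
exact: Psx.
Qed.

Lemma closed_preimage {T V : topologicalType} (h : T -> V) (D : set V) :
  continuous h -> closed D -> closed (h @^-1` D).
Proof. by move=> ch cD; apply: preimage_closed => // ? _; exact: ch. Qed.

Lemma compact_set_type {T : topologicalType} (D : set T) :
  compact D -> compact [set: D].
Proof.
move=> cD G PG _.
have PvG : ProperFilter ((fun x : D => val x) @ G) by exact: fmap_proper_filter.
have [|x [Dx clx]] := cD _ PvG.
  by apply: (@filterS _ G _ setT) filterT => x _; exact: set_valP.
exists (SigSub (mem_set Dx)); split=> // P Q GP [_ [/= [W oW <-] Wx] WQ].
have [||y [[z Pz <-] Wz]] := clx ((fun x : D => val x) @` P) W.
- by apply: (@filterS _ G _ P) GP => z Pz; exists z.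
- exact: open_nbhs_nbhs.
- by exists z; split=> //; exact: WQ.
Qed.

Lemma closed_image_val {T : topologicalType} (B : set T) (D : set B) :
  closed B -> closed D -> closed ((fun x : B => val x) @` D).
Proof.
move=> cB /closed_openC[W oW WD].
rewrite (_ : _ @` _ = B `&` ~` W); first by apply: closedI => //; rewrite closedC.
apply/seteqP; split=> [_ [x Dx <-]|x [Bx nWx]].
  split; first exact: set_valP.
  by move=> Wx; have : (~` D) x by rewrite -WD.
exists (SigSub (mem_set Bx)) => //; apply: contrapT => nDx; apply: nWx.
by have : (~` D) (SigSub (mem_set Bx)) by []; rewrite -WD.
Qed.

Lemma compact_unit_interval (R : realType) : compact [set: @unit_interval R].
Proof.
rewrite (_ : [set: @unit_interval R] = @to_unit R @` `[0, 1]).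
  apply: continuous_compact; last exact: segment_compact.
  exact/continuous_subspaceT/to_unit_continuous.
apply/seteqP; split=> // s _; exists (val s); last exact: to_unit_val.
exact: set_valP.
Qed.

Lemma closed_cover_continuous {T V : topologicalType} (I : finType)
    (D : I -> set T) (f : T -> V) :
  (forall i, closed (D i)) -> (forall x, exists i, D i x) ->
  (forall i, continuous (fun x : D i => f (val x))) -> continuous f.
Proof.
move=> cD covD cf; apply/continuous_closedP => Z cZ.
pose fD i := (fun x : D i => val x) @` ((fun x : D i => f (val x)) @^-1` Z).
rewrite (_ : _ @^-1` _ = \big[setU/set0]_(i <- enum I) fD i).
  apply: closed_bigsetU => i _; apply: closed_image_val => //.
  exact: (closed_preimage (cf i) cZ).
rewrite -bigcup_seq; apply/seteqP; split=> [x Zx|_ [i _ [y Zy <-]]//].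
have [i Dx] := covD x; exists i; first by rewrite /= mem_enum.
by exists (SigSub (mem_set Dx)).
Qed.

Lemma sum_continuous {R : realType} {T : topologicalType} {I : Type} (r : seq I)
    (P : pred I) (F : I -> T -> R) :
  (forall i, P i -> continuous (F i)) ->
  continuous (fun x => \sum_(i <- r | P i) F i x).
Proof. by move=> cF; apply: continuous_big => //; exact: add_continuous. Qed.

Section real_valued.
Context {R : realType} {T : topologicalType}.
Implicit Types f g : T -> R.

Lemma add_continuous2 f g :
  continuous f -> continuous g -> continuous (fun x => f x + g x).
Proof. by move=> cf cg x; apply: cvgD; [exact: cf|exact: cg]. Qed.

Lemma sub_continuous2 f g :
  continuous f -> continuous g -> continuous (fun x => f x - g x).
Proof. by move=> cf cg x; apply: cvgB; [exact: cf|exact: cg]. Qed.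

Lemma mul_continuous2 f g :
  continuous f -> continuous g -> continuous (fun x => f x * g x).
Proof. by move=> cf cg x; apply: cvgM; [exact: cf|exact: cg]. Qed.

Lemma max_continuous2 f g :
  continuous f -> continuous g -> continuous (fun x => Num.max (f x) (g x)).
Proof. by move=> cf cg x; apply: continuous_max; [exact: cf|exact: cg]. Qed.

Lemma min_continuous2 f g :
  continuous f -> continuous g -> continuous (fun x => Num.min (f x) (g x)).
Proof. by move=> cf cg x; apply: continuous_min; [exact: cf|exact: cg]. Qed.

Lemma div_continuous2 f g : continuous f -> continuous g ->
  (forall x, g x != 0) -> continuous (fun x => f x / g x).
Proof.
by move=> cf cg g0 x; apply: cvgM; [exact: cf|apply: cvgV; [exact: g0|exact: cg]].
Qed.

Lemma const_continuous (c : R) : continuous (fun _ : T => c).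
Proof. exact: cst_continuous. Qed.
End real_valued.

(** * Lifts by weights along chains *)

(** Continuous induction: at the supremum [s] of the [c] with [P 0 c], the local clause at [s] would
    lead past [s] unless 1 is reached first. It takes the place of a subdivision by a Lebesgue
    number. *)
Lemma interval_principle (R : realType) (P : R -> R -> Prop) :
  (forall a b c, a <= b -> b <= c -> P a b -> P b c -> P a c) ->
  (forall t, exists2 e, 0 < e & forall a b, t - e <= a -> b <= t + e -> P a b) ->
  P 0 1.
Proof.
move=> Ptrans Ploc; pose E := [set c | [/\ 0 <= c, c <= 1 & P 0 c]].
have [e0 e0_gt0 Pe0] := Ploc 0.
have E0 : E 0 by split=> //; apply: Pe0; lra.
have supE : has_sup E by split; [exists 0|exists 1 => c []].
pose s := sup E.
have ubE c : E c -> c <= s by move=> Ec; exact: (sup_upper_bound supE).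
have [e e_gt0 Pe] := Ploc s.
have [c [c0 c1 Pc] sc] := sup_adherent e_gt0 supE.
have cs : c <= s by exact: ubE.
have [d1|d1] := leP 1 (s + e).
  by apply: (Ptrans _ c) => //; apply: Pe => //; exact: ltW.
have /ubE : E (s + e).
  split; [lra|lra|]; apply: (Ptrans _ c) => //; first lra.
  by apply: Pe => //; exact: ltW.
by rewrite gerDl leNgt e_gt0.
Qed.

Section ChainWeights.
Context (R : realType) (X : topologicalType) (U : set (set X)).

Definition supp {T : topologicalType} (w : T -> R) : set T :=
  closure [set y | w y != 0].

Lemma supp_closed {T : topologicalType} (w : T -> R) : closed (supp w).
Proof. exact: closed_closure. Qed.

Lemma sub_supp {T : topologicalType} (w : T -> R) y : w y != 0 -> supp w y.
Proof. by move=> wy; exact: subset_closure. Qed.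

Lemma supp_sub {T : topologicalType} (w : T -> R) (D : set T) : closed D ->
  (forall y, w y != 0 -> D y) -> supp w `<=` D.
Proof.
move=> cD wD; apply: (@subset_trans _ (closure D)); first exact: closureS.
by rewrite -((closure_id D).1 cD).
Qed.

Lemma supp_comp {S T : topologicalType} (h : S -> T) (w : T -> R) :
  continuous h -> supp (fun y => w (h y)) `<=` h @^-1` supp w.
Proof.
move=> ch; apply: supp_sub => [|y]; last exact: sub_supp.
by apply: closed_preimage => //; exact: supp_closed.
Qed.

(* Up to normalization, the barycentric coordinates of a lift of [f] over [D].
   The topology of the realization is finer than the one induced by the
   coordinates: it is the closed supports that make such a lift continuous. *)
Record chain_weights {T : topologicalType} (f : T -> X) (D : set T)
    (S : seq (set X)) (w : set X -> T -> R) : Prop := ChainWeights {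
  cw_cts : forall A, continuous (w A);
  cw_ge0 : forall A y, 0 <= w A y;
  cw_out : forall A y, A \notin S -> w A y = 0;
  cw_mem : forall A, A \in S -> U A;
  cw_supp : forall A y, D y -> supp (w A) y -> A (f y);
  cw_chain : forall A B y, D y -> w A y != 0 -> w B y != 0 ->
    A `<=` B \/ B `<=` A;
  cw_neq0 : forall y, D y -> exists A, w A y != 0 }.

Arguments cw_cts {T f D S w} _ A.

Definition constraints {T : topologicalType} (f : T -> X)
    (L : seq (set X * set T)) :=
  forall V C, (V, C) \in L -> [/\ U V, closed C & C `<=` f @^-1` V].

(** The demand is made on the closed support, not only where the weight is nonzero: for [A] not
    inside [V] it says that the closed sets [supp (w A)] and [C] do not meet over [D], a condition
    that survives small displacements. *)
Definition subordinate {T : topologicalType} (L : seq (set X * set T))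
    (D : set T) (w : set X -> T -> R) :=
  forall A V C y, (V, C) \in L -> D y -> C y -> supp (w A) y -> A `<=` V.

(** Compactness is part of the notion: it makes a lift over one slice usable over nearby slices, and
    it bounds the number of sets that matter for a lift given near the boundary. *)
Definition liftable (K : topologicalType) := compact [set: K] /\
  forall f : K -> X, continuous f -> forall L, constraints f L ->
    exists S w, chain_weights f setT S w /\ subordinate L setT w.

Lemma supp_in {T : topologicalType} (f : T -> X) D S (w : set X -> T -> R) A y :
  chain_weights f D S w -> supp (w A) y -> A \in S.
Proof.
move=> wP; apply: contraPT => AS; rewrite /supp (_ : [set y | _] = set0).
  by rewrite closure0.
by apply/seteqP; split=> z //=; rewrite (cw_out wP)// eqxx.
Qed.

Lemma chain_weights_comp {K T : topologicalType} (h : K -> T) (f : T -> X) D S w :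
  continuous h -> chain_weights f D S w ->
  chain_weights (fun y => f (h y)) (h @^-1` D) S (fun A y => w A (h y)).
Proof.
move=> ch [wc w0 wS SU ws wC wn]; split=> //.
- by move=> A; exact: continuous_comp_fun (wc A).
- by move=> A y AS; exact: wS.
- by move=> A y Dy /(supp_comp ch); exact: ws.
- by move=> A B y; exact: wC.
- by move=> y; exact: wn.
Qed.

Lemma subordinate_comp {K T : topologicalType} (h : K -> T) L D w :
  continuous h -> subordinate L D w ->
  subordinate [seq (p.1, h @^-1` p.2) | p <- L] (h @^-1` D)
    (fun A y => w A (h y)).
Proof.
move=> ch wL A V C y /mapP[[V' C'] VC [-> ->]] /= Dy Cy /(supp_comp ch).
exact: wL VC Dy Cy.
Qed.

Lemma constraints_comp {K T : topologicalType} (h : K -> T) (f : T -> X) L :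
  continuous h -> constraints f L ->
  constraints (fun y => f (h y)) [seq (p.1, h @^-1` p.2) | p <- L].
Proof.
move=> ch fL V C /mapP[[V' C'] VC [-> ->]] /=; have [UV cC CV] := fL _ _ VC.
split=> //; last by move=> y /CV.
exact: closed_preimage.
Qed.

Lemma liftable_retract (K K' : topologicalType) (i : K -> K') (r : K' -> K) :
  continuous i -> continuous r -> cancel i r -> liftable K' -> liftable K.
Proof.
move=> ci cr ir [cK' lK']; split.
  rewrite (_ : [set: K] = r @` [set: K']).
    by apply: continuous_compact => //; exact: continuous_subspaceT.
  by apply/seteqP; split=> // y _; exists (i y).
move=> f cf L fL.
have [S [w [wP wL]]] := lK' _ (continuous_comp_fun cr cf) _ (constraints_comp cr fL).
exists S, (fun A y => w A (i y)); split.
  have := chain_weights_comp ci wP; rewrite preimage_setT.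
  by congr chain_weights; apply/funext => y; rewrite ir.
have := subordinate_comp ci wL; rewrite preimage_setT; congr subordinate.
rewrite -map_comp -[RHS]map_id; apply: eq_map => -[V C] /=; congr pair.
by apply/seteqP; split=> y /=; rewrite ir.
Qed.

Hypothesis hU : complete_open_cover U.

(** The intersection of the sets in [s] is a union of members of [U], and one of these contains [x].
    For empty [s] the intersection is all of [X]. *)
Lemma complete_cover_refine (s : seq (set X)) x :
  {in s, forall V, U V /\ V x} ->
  exists W, [/\ U W, W x & {in s, forall V, W `<=` V}].
Proof.
move=> sV; have [_ _ /(_ [set` s])] := hU.
case=> [V /= /sV[]//|//|Ws WsU WsE].
have : (\bigcup_(A in Ws) A) x.
  by rewrite WsE => V /= /sV[].
move=> [W WsW Wx]; exists W; split; [exact: WsU|by []|].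
move=> V Vs y Wy; have : (\bigcup_(A in Ws) A) y by exists W.
by rewrite WsE; exact.
Qed.

(** Base case of the induction on dimension, with a single set as support. The refinement property
    of the cover enters here; higher dimensions use it only through lifts over points. *)
Lemma liftable_point (K : topologicalType) (k0 : K) :
  (forall k, k = k0) -> liftable K.
Proof.
move=> Kk; have KE : [set: K] = [set k0].
  by apply/seteqP; split=> // y _ /=; exact: Kk.
split; first by rewrite KE; exact: compact_set1.
move=> f cf L fL.
pose s := [seq p.1 | p <- L & `[< p.2 k0 >]].
have [|W [UW Wf Ws]] := @complete_cover_refine s (f k0).
  move=> V /mapP[[V' C]]; rewrite mem_filter => /andP[/asboolP/= Ck0 VC ->].
  by have [? _ /(_ _ Ck0)] := fL _ _ VC; split.
exists [:: W], (fun A _ => (A == W)%:R).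
have eqW A y : supp (fun _ : K => (A == W)%:R : R) y -> A = W.
  move=> Ay; apply/eqP; apply: contraPT Ay => /negbTE ->.
  rewrite /supp (_ : [set _ | _] = set0) ?closure0//.
  by apply/seteqP; split=> z //=; rewrite eqxx.
split.
  split=> //.
  - by move=> A; exact: cst_continuous.
  - by move=> A y; rewrite inE => /negbTE ->.
  - by move=> A; rewrite inE => /eqP ->.
  - by move=> A y _ /eqW ->; rewrite (Kk y).
  - move=> A B y _ Ay By; left.
    have eqW0 C : (C == W)%:R != 0 :> R -> C = W.
      by case: (C =P W) => //; rewrite eqxx.
    by rewrite (eqW0 A Ay) (eqW0 B By).
  - by move=> y _; exists W; rewrite eqxx oner_eq0.
move=> A V C y VC _ Cy /eqW ->; apply: Ws; apply/mapP; exists (V, C) => //.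
by rewrite mem_filter VC andbT; apply/asboolP; rewrite -(Kk y).
Qed.

(** * Lifts over slabs, and the induction on the dimension of the cube *)

Section slices.
Context (K : topologicalType).

Lemma slice_continuous (t : R) : continuous (fun y : K => (y, t)).
Proof.
apply: (@continuous_pair _ _ _ id (cst t)) => x.
  exact: cvg_id.
exact: cvg_cst.
Qed.

(* Weights over a slice that are good there remain good, unchanged, over the
   nearby slices. *)
Lemma slice_lift (f : K * R -> X) (L : seq (set X * set (K * R))) (t : R) :
  liftable K -> continuous f -> constraints f L -> exists e S w,
  [/\ 0 < e, chain_weights (fun y => f (y, t)) setT S w &
    forall s, `|s - t| <= e -> forall y A, supp (w A) y ->
      A (f (y, s)) /\ forall V C, (V, C) \in L -> C (y, s) -> A `<=` V].
Proof.
move=> [cK lK] cf fL; have ct := @slice_continuous t.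
have [S [w [wP wL]]] := lK _ (continuous_comp_fun ct cf) _ (constraints_comp ct fL).
(* Tube lemma: the members of [U] are open and the supports and the sets [C] are closed, so each of
   the finitely many conditions holds near [(y, t)]; compactness of [K] makes the range of [s]
   uniform in [y]. *)
have : \forall s \near t, forall y, [set: K] y -> {in S, forall A, supp (w A) y ->
    A (f (y, s)) /\ {in L, forall p, p.2 (y, s) -> A `<=` p.1}}.
  apply: ((compact_near_coveringP _).1 cK R (nbhs t) (fun s y =>
    {in S, forall A, supp (w A) y -> A (f (y, s)) /\
      {in L, forall p, p.2 (y, s) -> A `<=` p.1}}) (nbhs_filter t)) => y _.
  suff : \forall z \near (y, t), {in S, forall A, supp (w A) z.1 ->
      A (f z) /\ {in L, forall p, p.2 z -> A `<=` p.1}}.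
    by apply: filterS => -[].
  have near_notin (C : set (K * R)) : closed C -> ~ C (y, t) ->
      \forall z \near (y, t), ~ C z.
    by move=> cC ?; apply: open_nbhs_nbhs; split=> //; rewrite openC.
  have csupp A : closed [set z : K * R | supp (w A) z.1].
    exact: closed_preimage (@continuous_fst _ _) (@supp_closed _ (w A)).
  apply: (@near_in _ _ (nbhs (y, t)) S (fun A z => supp (w A) z.1 ->
      A (f z) /\ {in L, forall p, p.2 z -> A `<=` p.1})
      (nbhs_filter (y, t))) => A AS.
  have [Ay|Ay] := pselect (supp (w A) y); last first.
    by apply: filterS (near_notin _ (csupp A) Ay) => z.
  have [oU _ _] := hU.
  have nA : \forall z \near (y, t), A (f z).
    apply: cf; apply: open_nbhs_nbhs; split; first exact/oU/(cw_mem wP).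
    exact: (cw_supp wP).
  have nL : \forall z \near (y, t),
      {in L, forall p, supp (w A) z.1 -> p.2 z -> A `<=` p.1}.
    apply: (@near_in _ _ (nbhs (y, t)) L
      (fun p z => supp (w A) z.1 -> p.2 z -> A `<=` p.1)
      (nbhs_filter (y, t))) => -[V C] VC /=.
    have [?|AV] := pselect (A `<=` V).
      exact: nearW.
    have [_ cC _] := fL _ _ VC.
    have nC : ~ ([set z : K * R | supp (w A) z.1] `&` C) (y, t).
      move=> [_ Cy]; apply: AV; apply: (wL A V ((fun y => (y, t)) @^-1` C) y) => //.
      by apply/mapP; exists (V, C).
    by apply: filterS (near_notin _ (closedI (csupp A) cC) nC) => z nz zA zC; case: nz.
  by apply: filterS2 nA nL => z Az Lz zA; split=> // p pL; exact: Lz.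
(* Halving turns the strict inequality of the ball into the weak one of the statement. *)
move=> /nbhs_ballP[e /= e0 eP]; exists (e / 2), S, w; split=> [|//|s st y A Ay].
  by rewrite divr_gt0.
have [|||Afs ALs] := eP s _ y _ A _ Ay => //.
- by rewrite /ball/= distrC (le_lt_trans st)// ltr_pdivrMr// ltr_pMr// ltr1n.
- exact: supp_in wP Ay.
- by split=> // V C VC; exact: (ALs (V, C) VC).
Qed.

Definition strip (a b : R) : set (K * R) := [set z | a <= z.2 <= b].

Lemma strip_closed a b : closed (strip a b).
Proof.
rewrite (_ : strip a b = (@snd K R) @^-1` [set x | a <= x] `&`
    (@snd K R) @^-1` [set x | x <= b]).
  by apply: closedI; apply: closed_preimage (@continuous_snd K R) _;
    [exact: closed_ge|exact: closed_le].
by apply/seteqP; split=> z /=; [move=> /andP|move=> [az zb]; apply/andP].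
Qed.

Definition liftable_on f (L : seq (set X * set (K * R))) a b := exists S w,
  chain_weights f (strip a b) S w /\ subordinate L (strip a b) w.

Lemma liftable_on_near (f : K * R -> X) L (t : R) :
  liftable K -> continuous f -> constraints f L -> exists2 e, 0 < e &
  forall a b, t - e <= a -> b <= t + e -> liftable_on f L a b.
Proof.
move=> lK cf fL; have [e [S [w [e0 wP we]]]] := slice_lift t lK cf fL.
exists e => // a b ta bt; exists S, (fun A z => w A z.1).
have te y s : strip a b (y, s) -> `|s - t| <= e.
  by rewrite /strip/= => /andP[as_ sb]; rewrite ler_norml; lra.
have supp1 A z : supp (fun z : K * R => w A z.1) z -> supp (w A) z.1.
  by move=> /(supp_comp (@continuous_fst K R)).
split.
  split.
  - by move=> A; exact: continuous_comp_fun (@continuous_fst K R) (cw_cts wP A).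
  - by move=> A z; exact: (cw_ge0 wP).
  - by move=> A z; exact: (cw_out wP).
  - exact: (cw_mem wP).
  - by move=> A [y s] /te ys /supp1 /(we _ ys)[].
  - by move=> A B z _; exact: (cw_chain wP).
  - by move=> z _; exact: (cw_neq0 wP).
move=> A V C [y s] VC /te ys Cy /supp1 Ay.
by have [_ AL] := we _ ys _ _ Ay; exact: AL VC Cy.
Qed.

(** The families [w] and [w'] are unrelated over the common slice [b]. A third family [m] over that
    slice, subordinate to the supports of both, forms chains with each, and the transition from [w]
    to [w'] passes through it. *)
Lemma liftable_on_glue (f : K * R -> X) L (a b c : R) :
  liftable K -> continuous f -> constraints f L -> a <= b -> b <= c ->
  liftable_on f L a b -> liftable_on f L b c -> liftable_on f L a c.
Proof.
move=> lK cf fL ab bc [S [w [wP wL]]] [S' [w' [w'P w'L]]].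
(* The supports are cut down to the strips because only there is [supp (w W)] known to be mapped
   into [W]. *)
pose Lw := [seq (W, supp (w W) `&` strip a b) | W <- S].
pose Lw' := [seq (W, supp (w' W) `&` strip b c) | W <- S'].
have [|e [T [m [e0 mP me]]]] := @slice_lift f (L ++ Lw ++ Lw') b lK cf.
  move=> V C; rewrite !mem_cat => /or3P[/fL//|/mapP|/mapP] [W WS [-> ->]]; split.
  - exact: (cw_mem wP).
  - by apply: closedI; [exact: supp_closed|exact: strip_closed].
  - by move=> z [Wz Dz]; exact: (cw_supp wP).
  - exact: (cw_mem w'P).
  - by apply: closedI; [exact: supp_closed|exact: strip_closed].
  - by move=> z [Wz Dz]; exact: (cw_supp w'P).
(* The factors of [w] and [w'] are never positive together, and both vanish at [b], where the tent
   of half-width [e] keeps [m] alive. Within that width [m] still satisfies its constraints. *)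
pose v A z := Num.max 0 (b - z.2) * w A z + Num.max 0 (z.2 - b) * w' A z +
  Num.max 0 (e - `|z.2 - b|) * m A z.1.
have max_mul (x y : R) : Num.max 0 x * y != 0 -> 0 < x /\ y != 0.
  by rewrite mulf_eq0 negb_or => /andP[]; case: ltP => //; rewrite eqxx.
have v_neq0 A z : v A z != 0 -> [\/ z.2 < b /\ w A z != 0,
    b < z.2 /\ w' A z != 0 | `|z.2 - b| < e /\ m A z.1 != 0].
  have [w0|/max_mul[]] := eqVneq (Num.max 0 (b - z.2) * w A z) 0; last first.
    by rewrite subr_gt0 => zb wz _; exact: Or31.
  have [w'0|/max_mul[]] := eqVneq (Num.max 0 (z.2 - b) * w' A z) 0; last first.
    by rewrite subr_gt0 => zb wz _; exact: Or32.
  rewrite /v w0 w'0 !add0r => /max_mul[].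
  by rewrite subr_gt0 => zb mz; exact: Or33.
have csnd : continuous (fun z : K * R => z.2 - b).
  by move=> z; apply: cvgB; [exact: cvg_snd|exact: cvg_cst].
have cdist : continuous (fun z : K * R => `|z.2 - b|).
  by apply: continuous_comp_fun csnd _; exact: norm_continuous.
have v_supp A z : supp (v A) z -> [\/ z.2 <= b /\ supp (w A) z,
    b <= z.2 /\ supp (w' A) z | `|z.2 - b| <= e /\ supp (m A) z.1].
  apply: (@supp_sub _ (v A) [set z | [\/ z.2 <= b /\ supp (w A) z,
    b <= z.2 /\ supp (w' A) z | `|z.2 - b| <= e /\ supp (m A) z.1]]).
  - rewrite (_ : [set _ | _] = ((snd @^-1` [set x | x <= b] `&` supp (w A)) `|`
        (snd @^-1` [set x | b <= x] `&` supp (w' A))) `|`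
        ((fun z : K * R => `|z.2 - b|) @^-1` [set x | x <= e] `&`
         fst @^-1` supp (m A))).
      apply: closedU; first apply: closedU; apply: closedI; try exact: supp_closed.
      + by apply: closed_preimage; [exact: continuous_snd|exact: closed_le].
      + by apply: closed_preimage; [exact: continuous_snd|exact: closed_ge].
      + by apply: closed_preimage => //; exact: closed_le.
      + by apply: closed_preimage; [exact: continuous_fst|exact: supp_closed].
    apply/seteqP; split=> {}z /=.
      by move=> [] ?; [left; left|left; right|right].
    by move=> [[]|] ?; [exact: Or31|exact: Or32|exact: Or33].
  - move=> {}z /v_neq0[[zb]|[zb]|[zb]] /sub_supp Az.
    + by apply: Or31; rewrite ltW.
    + by apply: Or32; rewrite ltW.
    + by apply: Or33; rewrite ltW.
have in_Lw A y s : w A (y, s) != 0 ->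
    (A, supp (w A) `&` strip a b) \in L ++ Lw ++ Lw'.
  move=> Az; have AS := supp_in wP (sub_supp Az).
  by rewrite !mem_cat; apply/or3P/Or32; apply/mapP; exists A.
have in_Lw' A y s : w' A (y, s) != 0 ->
    (A, supp (w' A) `&` strip b c) \in L ++ Lw ++ Lw'.
  move=> Az; have AS := supp_in w'P (sub_supp Az).
  by rewrite !mem_cat; apply/or3P/Or33; apply/mapP; exists A.
have strip_l y s : strip a c (y, s) -> s <= b -> strip a b (y, s).
  by rewrite /strip /= => /andP[-> _] ->.
have strip_r y s : strip a c (y, s) -> b <= s -> strip b c (y, s).
  by rewrite /strip /= => /andP[_ ->] ->.
exists (S ++ S' ++ T), v; split.
  split.
  - move=> A.
    have cmax (h : K * R -> R) : continuous h -> continuous (fun z => Num.max 0 (h z)).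
      by move=> ch z; apply: continuous_max; [exact: cvg_cst|exact: ch].
    have csub : continuous (fun z : K * R => b - z.2).
      by move=> z; apply: cvgB; [exact: cvg_cst|exact: cvg_snd].
    have csube : continuous (fun z : K * R => e - `|z.2 - b|).
      by move=> z; apply: cvgB; [exact: cvg_cst|exact: cdist].
    move=> z; apply: cvgD; first apply: cvgD; apply: cvgM.
    + exact: cmax csub z.
    + exact: (cw_cts wP A z).
    + exact: cmax csnd z.
    + exact: (cw_cts w'P A z).
    + exact: cmax csube z.
    + exact: (continuous_comp_fun (@continuous_fst K R) (cw_cts mP A)) z.
  - move=> A z; rewrite /v !addr_ge0// mulr_ge0 ?le_max ?lexx//.
    + exact: (cw_ge0 wP).
    + exact: (cw_ge0 w'P).
    + exact: (cw_ge0 mP).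
  - move=> A z; rewrite !mem_cat !negb_or => /and3P[AS AS' AT].
    by rewrite /v (cw_out wP)// (cw_out w'P)// (cw_out mP)// !mulr0 !addr0.
  - move=> A; rewrite !mem_cat => /or3P[].
    + exact: (cw_mem wP).
    + exact: (cw_mem w'P).
    + exact: (cw_mem mP).
  - move=> A [y s] /= /andP[as_ sc] /v_supp[/= [sb]|/= [sb]|/= [sb]].
    + by apply: (cw_supp wP); rewrite /strip /= as_.
    + by apply: (cw_supp w'P); rewrite /strip /= sb.
    + by move=> Ay; have [] := me _ sb _ _ Ay.
  - move=> A B [y s] Ds /v_neq0[] /= [sb Az] /v_neq0[] /= [sb' Bz].
    + by apply: (cw_chain wP) Az Bz; exact: strip_l Ds (ltW sb).
    + by have := lt_trans sb sb'; rewrite ltxx.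
    + right; have [_ mL] := me _ (ltW sb') _ _ (sub_supp Bz).
      by apply: (mL _ _ (in_Lw A y s Az)); split;
        [exact: sub_supp|exact: strip_l Ds (ltW sb)].
    + by have := lt_trans sb sb'; rewrite ltxx.
    + by apply: (cw_chain w'P) Az Bz; exact: strip_r Ds (ltW sb).
    + right; have [_ mL] := me _ (ltW sb') _ _ (sub_supp Bz).
      by apply: (mL _ _ (in_Lw' A y s Az)); split;
        [exact: sub_supp|exact: strip_r Ds (ltW sb)].
    + left; have [_ mL] := me _ (ltW sb) _ _ (sub_supp Az).
      by apply: (mL _ _ (in_Lw B y s Bz)); split;
        [exact: sub_supp|exact: strip_l Ds (ltW sb')].
    + left; have [_ mL] := me _ (ltW sb) _ _ (sub_supp Az).
      by apply: (mL _ _ (in_Lw' B y s Bz)); split;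
        [exact: sub_supp|exact: strip_r Ds (ltW sb')].
    + exact: (cw_chain mP) Az Bz.
  - move=> [y s] Ds.
    have gt0 A : (s < b -> w A (y, s) != 0) -> (b < s -> w' A (y, s) != 0) ->
        (s = b -> m A y != 0) -> v A (y, s) != 0.
      have mx x : 0 <= Num.max 0 x :> R by rewrite le_max lexx.
      have mx_gt0 x : 0 < x -> 0 < Num.max 0 x :> R by rewrite lt_max orbC => ->.
      have add3_gt0 (x1 x2 x3 : R) : 0 <= x1 -> 0 <= x2 -> 0 <= x3 ->
          [\/ 0 < x1, 0 < x2 | 0 < x3] -> 0 < x1 + x2 + x3.
        by move=> ? ? ? []; lra.
      move=> wA w'A mA; rewrite /v /= gt_eqF// add3_gt0 ?mulr_ge0//.
      + exact: (cw_ge0 wP).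
      + exact: (cw_ge0 w'P).
      + exact: (cw_ge0 mP).
      + have [sb|sb|sb] := ltgtP s b.
        * apply: Or31; rewrite mulr_gt0 ?mx_gt0 ?subr_gt0//.
          by rewrite lt0r (wA sb) (cw_ge0 wP).
        * apply: Or32; rewrite mulr_gt0 ?mx_gt0 ?subr_gt0//.
          by rewrite lt0r (w'A sb) (cw_ge0 w'P).
        * apply: Or33; rewrite mulr_gt0 ?mx_gt0//; last first.
            by rewrite lt0r (mA sb) (cw_ge0 mP).
          by rewrite sb subrr normr0 subr0.
    have [sb|sb|sb] := ltgtP s b.
    + have [A wA] := cw_neq0 wP (strip_l _ _ Ds (ltW sb)); exists A.
      by apply: gt0 => //; lra.
    + have [A wA] := cw_neq0 w'P (strip_r _ _ Ds (ltW sb)); exists A.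
      by apply: gt0 => //; lra.
    + have [A wA] := cw_neq0 mP (I : [set: K] y); exists A.
      by apply: gt0 => //; lra.
move=> A V C [y s] VC Ds Cy /v_supp[] /= [sb Ay].
- exact: wL VC (strip_l _ _ Ds sb) Cy Ay.
- exact: w'L VC (strip_r _ _ Ds sb) Cy Ay.
- have [_ mL] := me _ sb _ _ Ay; apply: (mL V C) Cy.
  by rewrite mem_cat VC.
Qed.

End slices.

(** Clamping extends the problem from the unit interval to all of [R], so that the slices at 0 and 1
    have neighbours on both sides and [interval_principle] applies without end cases. *)
Lemma liftable_prod (K : topologicalType) :
  liftable K -> liftable (K * @unit_interval R)%type.
Proof.
move=> lK; have [cK _] := lK; split.
  rewrite -setXTT; apply: compact_setX => //.
  exact: compact_unit_interval.
move=> f cf L fL.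
pose r (z : K * R) := (z.1, to_unit z.2).
have cr : continuous r.
  apply: (@continuous_pair _ _ _ fst (fun z => to_unit z.2)).
    exact: continuous_fst.
  exact: continuous_comp_fun (@continuous_snd _ _) (@to_unit_continuous R).
pose i (z : K * @unit_interval R) := (z.1, val z.2).
have ci : continuous i.
  apply: (@continuous_pair _ _ _ fst (fun z : K * @unit_interval R => val z.2)).
    exact: continuous_fst.
  exact: continuous_comp_fun (@continuous_snd _ _) (@continuous_val _ _).
have ri z : r (i z) = z by case: z => y s; rewrite /r /i /= to_unit_val.
pose L' := [seq (p.1, r @^-1` p.2) | p <- L].
have [S [w [wP wL]]] : liftable_on (fun z => f (r z)) L' 0 1.
  apply: interval_principle => [a b c ab bc|t].
    by apply: liftable_on_glue => //;
      [exact: continuous_comp_fun cf|exact: constraints_comp].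
  by apply: liftable_on_near => //;
    [exact: continuous_comp_fun cf|exact: constraints_comp].
exists S, (fun A z => w A (i z)).
have iT : i @^-1` strip 0 1 = setT.
  apply/seteqP; split=> // -[y s] _; rewrite /strip/=.
  by have := set_valP s; rewrite /unit_interval/= in_itv.
split.
  have := chain_weights_comp ci wP; rewrite iT.
  by congr chain_weights; apply/funext => y; rewrite ri.
have := subordinate_comp ci wL; rewrite iT; congr subordinate.
rewrite -map_comp -[RHS]map_id; apply: eq_map => -[V C] /=; congr pair.
by apply/seteqP; split=> y /=; rewrite ri.
Qed.

Lemma liftable_cube n : liftable (@cube R n).
Proof.
elim: n => [|n IHn].
  have c0 : (0 : 'rV[R]_0) \in @cube R 0 by apply/mem_set => -[].
  by apply: (@liftable_point (set_type (@cube R 0)) (SigSub c0)) => t;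
    apply/val_inj/rowP => -[].
have tl_in (t : @cube R n.+1) : \row_j val t 0 (lift ord0 j) \in @cube R n.
  by apply/mem_set => j; rewrite mxE; have := set_valP t; exact.
have hd_in (t : @cube R n.+1) : val t 0 ord0 \in @unit_interval R.
  by apply/mem_set; rewrite /unit_interval /= in_itv; have := set_valP t; exact.
have cons_in (z : @cube R n * @unit_interval R) :
    \row_j (if unlift ord0 j is Some k then val z.1 0 k else val z.2) \in @cube R n.+1.
  apply/mem_set => j; rewrite mxE; case: unliftP => [k|] _.
    by have := set_valP z.1; exact.
  by have := set_valP z.2; rewrite /unit_interval /= in_itv.
pose tl t : @cube R n := SigSub (tl_in t).
pose hd t : @unit_interval R := SigSub (hd_in t).
pose i t := (tl t, hd t).
pose r z : @cube R n.+1 := SigSub (cons_in z).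
have cval m (j : 'I_m) : continuous (fun t : @cube R m => val t 0 j).
  exact: continuous_comp_fun (@continuous_val _ _) (@coord_continuous _ _ _ _ _).
apply: (@liftable_retract _ _ i r) (liftable_prod IHn).
- apply: (@continuous_pair _ _ _ tl hd).
    apply: continuous_subtype; apply: mx_continuous => k j.
    by under [X in continuous X]eq_fun do rewrite /= mxE; exact: cval.
  by apply: continuous_subtype; exact: cval.
- apply: continuous_subtype; apply: mx_continuous => k j.
  under [X in continuous X]eq_fun do rewrite /= mxE.
  case: unlift => [l|].
    exact: continuous_comp_fun (@continuous_fst _ _) (cval _ l).
  exact: continuous_comp_fun (@continuous_snd _ _) (@continuous_val _ _).
- move=> t; apply/val_inj/rowP => j; rewrite mxE /=.
  by case: unliftP => [k ->|->]; rewrite ?mxE.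
Qed.

End ChainWeights.

Arguments cw_cts {R X U T f D S w} _ A.

(** * Barycentric coordinates *)

Lemma sigT_prod_continuous {I : choiceType} {F : I -> topologicalType}
    {Z W : topologicalType} (h : {i & F i} * Z -> W) :
  (forall i, continuous (fun p : F i * Z => h (existT F i p.1, p.2))) ->
  continuous h.
Proof.
move=> ch [[i x] z] A nA.
have [[P Q] [/= nP nQ] PQ] := ch i (x, z) A nA.
exists (existT F i @` P, Q) => /=; first by split=> //; exact: existT_nbhs.
by move=> [_ z'] /= [[x' Px' <-] Qz']; exact: (PQ (x', z')).
Qed.

Section Hocolim.
Context (R : realType) (X : topologicalType) (U : set (set X)).

Local Notation C := (cover_category U).
Local Notation F := (cover_functor U).
Local Notation E := (hocolim F R).

Definition cell n (s : cat_string C n) (x : F (s ord_max)) (t : std_simplex R n) : E :=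
  \pi_(E) (existT (fun n => bar F n * std_simplex R n)%type n
    (existT (fun s : cat_string C n => F (s ord_max)) s x, t)).

Lemma cellP (e : E) : exists n s x t, e = @cell n s x t.
Proof.
by rewrite -[e]reprK; case: (repr e) => n [[s x] t]; exists n, s, x, t.
Qed.

Lemma cell_space n s x t : hocolim_to_space U R (@cell n s x t) = val x.
Proof. exact: hocolim_to_spaceE. Qed.

(** The integral of [phi] against the measure on [U] that puts mass [t_i] at [s i]. Simplicial
    operators preserve this measure, so continuous expressions in it descend to the realization. *)
Definition integ n (s : cat_string C n) (t : std_simplex R n) (phi : set X -> R) :=
  \sum_i val t 0 i * phi (val (s i)).

Lemma integ_push m n (f : simp_op m n) s t phi :
  integ s (std_simplex_push f t) phi = integ (str_pull f s) t phi.
Proof.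
rewrite /integ [RHS](partition_big f predT)//=; apply: eq_bigr => j _.
by rewrite mxE mulr_suml; apply: eq_bigr => i /eqP <-.
Qed.

Lemma cell_continuous n s : continuous (fun p => @cell n s p.1 p.2).
Proof.
pose T n : topologicalType := (bar F n * std_simplex R n)%type.
have c1 : continuous (fun p : F (s ord_max) * std_simplex R n =>
    (existT (fun s : cat_string C n => F (s ord_max) : topologicalType) s p.1, p.2) : T n).
  apply: continuous_pair; last exact: continuous_snd.
  exact: continuous_comp_fun (@continuous_fst _ _) (@existT_continuous _ _ s).
apply: (continuous_comp_fun (continuous_comp_fun c1 (@existT_continuous nat T n))).
exact: pi_continuous.
Qed.

Lemma std_simplex_coord n (i : 'I_n.+1) : continuous (fun t : std_simplex R n => val t 0 i).
Proof.
exact: continuous_comp_fun (@continuous_val _ _) (@coord_continuous _ _ _ _ _).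
Qed.

Section lift.
Variables (phi : forall n, cat_string C n -> std_simplex R n -> R).
Hypothesis phi_cts : forall n s, continuous (@phi n s).
Hypothesis phi_push : forall m n (f : simp_op m n) s t,
  phi s (std_simplex_push f t) = phi (str_pull f s) t.

Let pre (y : {n & bar F n * std_simplex R n}%type) : R :=
  phi (projT1 (projT2 y).1) (projT2 y).2.

Local Lemma pre_cts : continuous pre.
Proof.
pose g n (y : bar F n * std_simplex R n) := phi (projT1 y.1) y.2.
rewrite (_ : pre = sigT_fun g); last by apply/funext => -[n y].
apply: sigT_continuous => n; apply: sigT_prod_continuous => s.
exact: continuous_comp_fun (@continuous_snd _ _) (@phi_cts _ _).
Qed.

Local Lemma pre_rel x y : realization_rel x y -> pre x = pre y.
Proof. by case=> m n f [s {}x] t; rewrite /pre /= phi_push. Qed.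

Definition cell_lift : E -> R := glue_lift pre_cts pre_rel.

Lemma cell_lift_cts : continuous cell_lift.
Proof. exact: glue_lift_continuous. Qed.

Lemma cell_liftE n s x t : cell_lift (@cell n s x t) = phi s t.
Proof. exact: glue_liftE. Qed.

End lift.

Lemma integ_continuous n (s : cat_string C n) phi :
  continuous (fun t => integ s t phi).
Proof.
apply: sum_continuous => i _; apply: mul_continuous2; last exact: const_continuous.
exact: std_simplex_coord.
Qed.

Definition ind (A B : set X) : R := (B == A)%:R.

Definition bary (A : set X) : E -> R :=
  @cell_lift (fun n s t => integ s t (ind A)) (fun n s => @integ_continuous n s _)
    (fun m n f s t => integ_push f s t _).

Lemma bary_continuous A : continuous (bary A).
Proof. exact: cell_lift_cts. Qed.

Lemma baryE A n s x t : bary A (@cell n s x t) = integ s t (ind A).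
Proof. exact: cell_liftE. Qed.

Lemma sqsum_pre_cts n (s : cat_string C n) :
  continuous (fun t => integ s t (fun A => integ s t (ind A))).
Proof.
apply: sum_continuous => i _; apply: mul_continuous2; last exact: integ_continuous.
exact: std_simplex_coord.
Qed.

Lemma sqsum_pre_push m n (f : simp_op m n) s t :
  integ s (std_simplex_push f t) (fun A => integ s (std_simplex_push f t) (ind A)) =
  integ (str_pull f s) t (fun A => integ (str_pull f s) t (ind A)).
Proof.
by rewrite integ_push; congr integ; apply/funext => A; rewrite integ_push.
Qed.

(** The sum of the squares of the barycentric coordinates, written as the integral of the
    coordinates against their own measure. In this form it is a finite sum on each cell, even if [U]
    is infinite, and its continuity is checked cell by cell. *)
Definition sqsum : E -> R :=
  @cell_lift (fun n s t => integ s t (fun A => integ s t (ind A)))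
    sqsum_pre_cts sqsum_pre_push.

Lemma sqsum_continuous : continuous sqsum.
Proof. exact: cell_lift_cts. Qed.

Lemma sqsumE n s x t :
  sqsum (@cell n s x t) = integ s t (fun A => integ s t (ind A)).
Proof. exact: cell_liftE. Qed.

Lemma str_sub n (s : cat_string C n) (i j : 'I_n.+1) :
  (i <= j)%N -> val (s j) `<=` val (s i).
Proof. by move=> ij; exact: (str_arr s ij). Qed.

Lemma simplex_ge0 n (t : std_simplex R n) i : 0 <= val t 0 i.
Proof. by have [t0 _] := set_valP t; exact: t0. Qed.

Lemma simplex_sum1 n (t : std_simplex R n) : \sum_i val t 0 i = 1.
Proof. by have [_ t1] := set_valP t. Qed.

Lemma integE n (s : cat_string C n) t (S : seq (set X)) phi : uniq S ->
  (forall i, val (s i) \in S) ->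
  integ s t phi = \sum_(A <- S) phi A * integ s t (ind A).
Proof.
move=> uS sS; under eq_bigr do rewrite /integ mulr_sumr.
rewrite exchange_big /=; apply: eq_bigr => i _.
rewrite (bigD1_seq (val (s i)) (sS i) uS) big1 => [|A As]; rewrite /ind.
  by rewrite eqxx mulr1 /= addr0 mulrC.
by rewrite eq_sym (negbTE As) !mulr0.
Qed.

Lemma bary_ge0 A e : 0 <= bary A e.
Proof.
have [n [s [x [t ->]]]] := cellP e; rewrite baryE.
by apply: sumr_ge0 => i _; rewrite mulr_ge0 ?simplex_ge0 ?ler0n.
Qed.

Lemma integ_neq0 n (s : cat_string C n) t A :
  integ s t (ind A) != 0 -> exists2 i, val (s i) = A & val t 0 i != 0.
Proof.
move=> /eqP; apply: contra_notP => sA; apply: big1 => i _.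
rewrite /ind; case: eqP => [si|]; last by rewrite mulr0.
by rewrite mulr1; apply/eqP; apply: contra_notT sA => ti; exists i.
Qed.

Lemma bary_gt0_integ n (s : cat_string C n) (t : std_simplex R n) i :
  0 < val t 0 i -> 0 < integ s t (ind (val (s i))).
Proof.
move=> ti; rewrite /integ (bigD1 i)//= /ind eqxx mulr1 ltr_wpDr// sumr_ge0// => j _.
by rewrite mulr_ge0 ?simplex_ge0 ?ler0n.
Qed.

Lemma bary_mem A e : bary A e != 0 -> U A /\ A (hocolim_to_space U R e).
Proof.
have [n [s [x [t ->]]]] := cellP e; rewrite baryE cell_space.
move=> /integ_neq0[i <- _]; split; first exact: set_valP.
by apply: (@str_sub _ s i ord_max (leq_ord i)); exact: set_valP.
Qed.

Lemma bary_chain A B e : bary A e != 0 -> bary B e != 0 ->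
  A `<=` B \/ B `<=` A.
Proof.
have [n [s [x [t ->]]]] := cellP e; rewrite !baryE.
move=> /integ_neq0[i <- _] /integ_neq0[j <- _].
by have [ij|ji] := leqP i j; [right; exact: str_sub|left; exact/str_sub/ltnW].
Qed.

Lemma bary_support e : exists S : seq (set X), [/\ uniq S,
  forall A, A \notin S -> bary A e = 0, \sum_(A <- S) bary A e = 1 &
  sqsum e = \sum_(A <- S) bary A e ^+ 2].
Proof.
have [n [s [x [t ->]]]] := cellP e.
pose S := undup [seq val (s i) | i <- enum 'I_n.+1].
have sS i : val (s i) \in S.
  by rewrite mem_undup; apply/mapP; exists i; rewrite ?mem_enum.
have uS : uniq S by exact: undup_uniq.
exists S; split=> // [A AS||].
- rewrite baryE; apply/eqP; apply: contraNT AS => /integ_neq0[i <- _].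
  exact: sS.
- under eq_bigr do rewrite baryE -[integ _ _ _]mul1r.
  rewrite -(@integE n s t S (cst 1))// /integ -[RHS](simplex_sum1 t).
  by apply: eq_bigr => i _; rewrite mulr1.
- by rewrite sqsumE (integE _ _ uS sS); apply: eq_bigr => A _; rewrite baryE.
Qed.

Lemma bary_sum_le1 (S : seq (set X)) e : uniq S -> \sum_(A <- S) bary A e <= 1.
Proof.
move=> uS; have [S' [uS' S'0 <- _]] := bary_support e.
rewrite [leLHS](bigID (mem S'))/= [X in _ + X]big1 ?addr0; last by move=> A /S'0.
rewrite [leRHS](bigID (mem S))/= -big_filter -[in leRHS]big_filter.
rewrite (perm_big [seq i <- S' | i \in S]).
  by rewrite lerDl sumr_ge0// => A _; exact: bary_ge0.
apply: uniq_perm; rewrite ?filter_uniq// => A.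
by rewrite !mem_filter andbC.
Qed.

Lemma sqsum_gt0 e : 0 < sqsum e.
Proof.
have [S [uS S0 S1 ->]] := bary_support e.
rewrite lt_neqAle sumr_ge0 ?andbT; last by move=> A _; exact: sqr_ge0.
apply: contra_eqN S1 => /eqP/esym/eqP; rewrite psumr_eq0; last by move=> A _; exact: sqr_ge0.
move=> /allP Sz; rewrite big_seq big1 => [|A /Sz/=]; first by rewrite eq_sym oner_eq0.
by rewrite sqrf_eq0 => /eqP.
Qed.

(** The coordinates are nonnegative with sum 1, so the sum of their squares is a weighted mean of
    them and cannot exceed them all. *)
Lemma sqsum_le_bary e : exists A, sqsum e <= bary A e.
Proof.
apply: contrapT => /forallNP Ae; have [S [uS S0 S1 sE]] := bary_support e.
have : sqsum e < sqsum e.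
  rewrite {1}sE -[ltRHS]mulr1 -S1 mulr_sumr.
  have SA A : bary A e ^+ 2 <= sqsum e * bary A e.
    rewrite expr2 ler_wpM2r ?bary_ge0// ltW// ltNge; exact/negP/Ae.
  rewrite lt_neqAle ler_sum ?andbT//; apply/negP => /eqP sumE.
  have : \sum_(A <- S) (sqsum e * bary A e - bary A e ^+ 2) == 0.
    by rewrite sumrB sumE subrr.
  rewrite psumr_eq0; last by move=> A _; rewrite subr_ge0.
  move=> /allP Sz; have : \sum_(A <- S) bary A e == 0.
    rewrite big_seq big1// => A /Sz/=; rewrite expr2 -mulrBl mulf_eq0.
    case/orP => /eqP // s0; have [] := Ae A; rewrite -subr_le0 s0//.
  by rewrite S1 oner_eq0.
by rewrite ltxx.
Qed.

End Hocolim.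

(** * Points are determined by their image and their coordinates *)

Section Hocolim.
Context (R : realType) (X : topologicalType) (U : set (set X)).

Local Notation C := (cover_category U).
Local Notation F := (cover_functor U).
Local Notation E := (hocolim F R).

Definition chain_string n (g : 'I_n.+1 -> C)
    (g_mono : forall i j : 'I_n.+1, (i <= j)%N -> val (g j) `<=` val (g i)) :
    cat_string C n :=
  @CatString C n g g_mono
    (fun i _ => @Prop_irrelevance (val (g i) `<=` val (g i)) _ _)
    (fun i _ k _ _ _ => @Prop_irrelevance (val (g k) `<=` val (g i)) _ _).

Lemma cat_string_ext n (s s' : cat_string C n) : s =1 s' -> s = s'.
Proof.
case: s s' => [g a i c] [g' a' i' c'] /= /funext gg; subst g'.
have aa' : a = a' := @Prop_irrelevance (forall j k : 'I_n.+1, (j <= k)%N ->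
  val (g k) `<=` val (g j)) a a'.
by subst a'; congr CatString; exact: Prop_irrelevance.
Qed.

(** The gluing relation, with the pulled-back string and point given only up to pointwise equality;
    this keeps transports along equal strings out of later arguments. *)
Lemma cell_push m n (f : simp_op m n) (s0 : cat_string C m) (s : cat_string C n)
    (x0 : F (s0 ord_max)) (x : F (s ord_max)) (t : std_simplex R m) :
  (forall i, s0 i = s (f i)) -> val x0 = val x ->
  cell x0 t = cell x (std_simplex_push f t).
Proof.
move=> s0E; have {s0E}: s0 = str_pull f s by apply: cat_string_ext => i; exact: s0E.
move=> s0E; subst s0 => x0x.
have -> : cell x0 t = \pi_(E) (existT (fun n => bar F n * std_simplex R n)%type m
    (bar_act F f (existT (fun s : cat_string C n => F (s ord_max)) s x), t)).
  suff -> : bar_act F f (existT (fun s : cat_string C n => F (s ord_max)) s x) =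
    existT (fun s : cat_string C m => F (s ord_max)) (str_pull f s) x0 by [].
  rewrite /bar_act /=; congr (existT (fun s : cat_string C m => F (s ord_max)) _ _).
  exact/val_inj.
by apply/glue_space_eqP/rst_step; exact: RealizationRel.
Qed.

Lemma cell_face n (s : cat_string C n.+1) (x : F (s ord_max))
    (t : std_simplex R n.+1) i :
  val t 0 i = 0 -> exists s' x' t', cell x t = @cell R X U n s' x' t'.
Proof.
move=> ti0.
have lm : {homo (lift i : 'I_n.+1 -> 'I_n.+2) : j k / (j <= k)%N}.
  by move=> j k jk; rewrite /= leq_bump2.
pose f := SimpOp lm.
have tP : \row_j val t 0 (lift i j) \in std_simplex R n.
  apply/mem_set; split=> [j|]; first by rewrite mxE; exact: simplex_ge0.
  under eq_bigr do rewrite mxE.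
  have := simplex_sum1 t; rewrite (bigD1 i)//= ti0 add0r => <-.
  rewrite (reindex_omap (lift i) (unlift i)) => [|j]; last first.
    by rewrite eq_sym => /unlift_some[k -> ->].
  by apply: eq_bigl => j; rewrite liftK eqxx eq_sym neq_lift.
pose t' : std_simplex R n := SigSub tP.
have xP : val x \in val (str_pull f s ord_max).
  by apply/mem_set/(@str_sub _ _ _ s _ ord_max (leq_ord _))/set_valP.
exists (str_pull f s), (SigSub xP), t'.
rewrite (@cell_push _ _ f _ s (SigSub xP) x)//; congr cell.
apply/val_inj/rowP => j; rewrite mxE /=.
have [->|] := eqVneq j i.
  rewrite ti0 big1// => k; by rewrite eq_sym (negbTE (neq_lift _ _)).
rewrite eq_sym => /unlift_some[k -> _].
rewrite (bigD1 k)//= big1 ?addr0 ?mxE// => l /andP[/eqP/lift_inj ->].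
by rewrite eqxx.
Qed.

(** Vertices of coordinate 0 are dropped one at a time. The resulting string may still repeat a
    set. *)
Lemma cell_pos (e : E) : exists n s x (t : std_simplex R n),
  e = @cell R X U n s x t /\ forall i, 0 < val t 0 i.
Proof.
have [n [s [x [t ->]]]] := cellP e.
elim: n s x t => [|n IHn] s x t; have [tn0|] := pselect (forall i, val t 0 i != 0).
- by exists 0%N, s, x, t; split=> // i; rewrite lt_neqAle eq_sym tn0 simplex_ge0.
- move=> /existsNP[i /negP/negPn/eqP ti0]; have := simplex_sum1 t.
  have i0 : i = ord0 by exact: ord1.
  by rewrite i0 in ti0; rewrite big_ord1 ti0 => /eqP; rewrite eq_sym oner_eq0.
- by exists n.+1, s, x, t; split=> // i; rewrite lt_neqAle eq_sym tn0 simplex_ge0.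
- move=> /existsNP[i /negP/negPn/eqP ti0].
  by have [s' [x' [t' ->]]] := cell_face x ti0.
Qed.

(** One index is selected for each set occurring in the string, so that the mass of all its
    repetitions can be gathered there. *)
Lemma string_section n (s : cat_string C n) : exists c : 'I_n.+1 -> 'I_n.+1,
  (forall j, s (c j) = s j) /\ (forall j k, s j = s k -> c j = c k).
Proof.
pose c j := odflt j [pick k | s k == s j].
have cE j : s (c j) = s j.
  by rewrite /c; case: pickP => [k /eqP|/(_ j)]; rewrite ?eqxx.
exists c; split=> // j k sjk; rewrite /c sjk.
by case: pickP => [//|/(_ k)]; rewrite eqxx.
Qed.

(** An inversion of [f] would give inclusions both ways between [s (f i)] and [s (f j)]; the sets
    would be equal, hence so would their selected indices. *)
Lemma section_homo m n (r : cat_string C m) (s : cat_string C n)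
    (c : 'I_n.+1 -> 'I_n.+1) (f : 'I_m.+1 -> 'I_n.+1) :
  (forall j k, s j = s k -> c j = c k) -> (forall i, s (f i) = r i) ->
  (forall i, c (f i) = f i) -> {homo f : i j / (i <= j)%N}.
Proof.
move=> cs sf cf i j ij; rewrite leqNgt; apply/negP => fji.
suff : f i = f j by move=> e; rewrite e ltnn in fji.
rewrite -cf -[RHS]cf; apply: cs; apply/val_inj/seteqP; split.
  by apply: str_sub; exact: ltnW.
by rewrite !sf; exact: str_sub.
Qed.

(** Both cells are pushed into [s'], along [f] and [c], with the mass of each set gathered at its
    selected index; equal measures then become equal coordinates. Positivity of [t] guarantees that
    every set of [s] occurs in [s']. *)
Lemma cell_inj_pos m n (s : cat_string C m) (s' : cat_string C n)
    (x : F (s ord_max)) (x' : F (s' ord_max)) (t : std_simplex R m)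
    (t' : std_simplex R n) :
  val x = val x' -> (forall A, integ s t (ind R A) = integ s' t' (ind R A)) ->
  (forall i, 0 < val t 0 i) -> cell x t = cell x' t'.
Proof.
move=> xx' ss' t0; have [c [sc cs]] := string_section s'.
have /choice[f0 f0P] : forall i, exists j, s' j = s i.
  move=> i; have := bary_gt0_integ s (t0 i); rewrite ss' => /lt0r_neq0.
  by move=> /integ_neq0[j sj _]; exists j; exact/val_inj.
pose f i := c (f0 i).
have cc j : c (c j) = c j by apply: cs; rewrite sc.
have sf i : s' (f i) = s i by rewrite /f sc.
have cf i : c (f i) = f i by exact: cc.
have fH : {homo f : i j / (i <= j)%N} by exact: section_homo cs sf cf.
have cH : {homo c : i j / (i <= j)%N} by exact: section_homo cs sc cc.
rewrite (@cell_push _ _ (SimpOp fH) s s' x x' t)//.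
rewrite (@cell_push _ _ (SimpOp cH) s' s' x' x' t')//.
congr cell; apply/val_inj/rowP => j; rewrite !mxE /=.
have [cj|cj] := eqVneq (c j) j; last first.
  rewrite !big1// => i /eqP ij; move: cj; rewrite -ij ?cc ?cf eqxx//.
have := ss' (val (s' j)); rewrite /integ /ind.
have sum_ind p (r : cat_string C p) (u : 'I_p.+1 -> R) (P : pred 'I_p.+1) :
    (forall i, P i = (val (r i) == val (s' j))) ->
    \sum_i u i * (val (r i) == val (s' j))%:R = \sum_(i | P i) u i.
  move=> Pr; rewrite [RHS]big_mkcond; apply: eq_bigr => i _.
  by rewrite Pr; case: eqP => _; rewrite ?mulr1 ?mulr0.
rewrite (sum_ind _ s (fun i => val t 0 i) (fun i => f i == j)) => [|i].
  rewrite (sum_ind _ s' (fun i => val t' 0 i) (fun i => c i == j)) => [//|i].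
  apply/eqP/eqP => [<-|/val_inj sij]; first by rewrite sc.
  by rewrite -cj; exact: cs.
apply/eqP/eqP => [<-|/val_inj sij]; first by rewrite sf.
by rewrite -cj -(cf i); apply: cs; rewrite sf.
Qed.

Lemma hocolim_ext (e e' : E) :
  hocolim_to_space U R e = hocolim_to_space U R e' ->
  (forall A, bary A e = bary A e') -> e = e'.
Proof.
have [m [s [x [t [-> t0]]]]] := cell_pos e.
have [n [s' [x' [t' ->]]]] := cellP e'.
rewrite !cell_space => xx' ee'; apply: cell_inj_pos => // A.
by rewrite -(baryE A x t) -(baryE A x' t').
Qed.

End Hocolim.

(** * Lifts from weights *)

Section Hocolim.
Context (R : realType) (X : topologicalType) (U : set (set X)).

Local Notation C := (cover_category U).
Local Notation F := (cover_functor U).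
Local Notation E := (hocolim F R).

(** The order is decreasing because the arrows of a string run from high to low index: the smallest
    set stands at [ord_max], where the base point has to lie. *)
Lemma chain_sort (Q : seq (set X)) : uniq Q -> (0 < size Q)%N ->
  {in Q, forall A, U A} -> {in Q &, forall A B, A `<=` B \/ B `<=` A} ->
  exists n (s : cat_string C n), perm_eq [seq val (s i) | i <- enum 'I_n.+1] Q.
Proof.
move=> uQ Q0 QU Qc; pose ge (A B : set X) := `[< B `<=` A >].
pose Q' := sort ge Q.
have perQ : perm_eq Q' Q by rewrite perm_sort.
have sQ' : size Q' = (size Q).-1.+1 by rewrite (perm_size perQ) prednK.
have memQ (i : 'I_(size Q).-1.+1) : nth set0 Q' i \in Q.
  by rewrite -(perm_mem perQ) mem_nth// sQ'.
have sortedQ : sorted ge Q'.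
  apply: (@sort_sorted_in _ [in Q]) => [A B AQ BQ|]; last exact/allP.
  by apply/orP; case: (Qc _ _ AQ BQ) => ?; [right|left]; apply/asboolP.
have gP (i : 'I_(size Q).-1.+1) : nth set0 Q' i \in U.
  exact/mem_set/QU/memQ.
pose g (i : 'I_(size Q).-1.+1) : C := SigSub (gP i).
have g_mono (i j : 'I_(size Q).-1.+1) : (i <= j)%N -> val (g j) `<=` val (g i).
  move=> ij; apply/asboolP; rewrite -/(ge _ _).
  apply: (sorted_leq_nth _ _ set0 sortedQ) => //.
  - by move=> A B D /asboolP AB /asboolP BD; apply/asboolP; exact: subset_trans BD AB.
  - by move=> A; apply/asboolP.
  - by rewrite inE sQ'.
  - by rewrite inE sQ'.
exists (size Q).-1, (chain_string g_mono).
suff -> : [seq val (chain_string g_mono i) | i <- enum 'I_(size Q).-1.+1] = Q' by [].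
apply: (@eq_from_nth _ set0); first by rewrite size_map size_enum_ord sQ'.
move=> i; rewrite size_map size_enum_ord => iQ.
by rewrite (nth_map ord0) ?size_enum_ord//= nth_enum_ord.
Qed.

Lemma sum_off_zero (S Q : seq (set X)) (w : set X -> R) : uniq S -> uniq Q ->
  (forall A, A \notin S -> w A = 0) -> (forall A, A \notin Q -> w A = 0) ->
  \sum_(A <- S) w A = \sum_(A <- Q) w A.
Proof.
move=> uS uQ wS wQ.
rewrite (bigID (mem Q))/= [X in _ + X]big1 ?addr0; last by move=> A /wQ.
rewrite [RHS](bigID (mem S))/= [X in _ = _ + X]big1 ?addr0; last by move=> A /wS.
rewrite -big_filter -[RHS]big_filter; apply: perm_big.
apply: uniq_perm; rewrite ?filter_uniq// => A.
by rewrite !mem_filter andbC.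
Qed.

Lemma weights_integ n (s : cat_string C n) (t : std_simplex R n) (w : set X -> R)
    (Q : seq (set X)) A :
  perm_eq [seq val (s i) | i <- enum 'I_n.+1] Q ->
  (forall B, B \notin Q -> w B = 0) -> uniq Q ->
  (forall i, val t 0 i = w (val (s i))) -> integ s t (ind R A) = w A.
Proof.
move=> sQ wQ uQ tw.
have : integ s t (ind R A) = \sum_(B <- Q) (w B * (B == A)%:R).
  rewrite -(perm_big _ sQ) big_map big_enum/=.
  by apply: eq_bigr => i _; rewrite tw.
have [AQ ->|/negP AQ ->] := pselect (is_true (A \in Q)); last first.
  rewrite wQ// big_seq big1// => B BQ; case: eqP => [BA|]; last by rewrite mulr0.
  by move: AQ; rewrite -BA BQ.
rewrite (bigD1_seq A)//= eqxx mulr1 big1 ?addr0// => B /negbTE ->.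
by rewrite mulr0.
Qed.

Section charts.
Context {T : topologicalType} (f : T -> X) (S : seq (set X)) (w : set X -> T -> R).
Hypotheses (uS : uniq S) (wP : chain_weights U f setT S w).

Definition wsum y := \sum_(A <- S) w A y.

Lemma wsum_gt0 y : 0 < wsum y.
Proof.
have [A Ay] := cw_neq0 wP (I : setT y).
have AS : A \in S by apply: contraNT Ay => /(cw_out wP) ->.
rewrite /wsum (bigD1_seq A)//= ltr_pwDl//; first by rewrite lt0r Ay (cw_ge0 wP).
by rewrite sumr_ge0// => B _; exact: (cw_ge0 wP).
Qed.

Lemma wsum_continuous : continuous wsum.
Proof. by apply: sum_continuous => A _; exact: (cw_cts wP). Qed.

(** One string serves for all of [D], so the lift factors through a single cell and is continuous.
    Every set of [Q] must contain [f y], also where its weight vanishes, for the base point to lie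
    in the smallest one. *)
Lemma chart (D : set T) (Q : seq (set X)) : uniq Q -> (0 < size Q)%N ->
  {in Q, forall A, U A} -> {in Q &, forall A B, A `<=` B \/ B `<=` A} ->
  (forall y A, D y -> A \notin Q -> w A y = 0) ->
  (forall y A, D y -> A \in Q -> A (f y)) -> continuous f ->
  exists g : D -> E, [/\ continuous g,
    forall y, hocolim_to_space U R (g y) = f (val y) &
    forall A y, bary A (g y) = w A (val y) / wsum (val y)].
Proof.
move=> uQ Q0 QU Qc DQ0 DQ cf; have [n [s sQ]] := chain_sort uQ Q0 QU Qc.
have xP (y : D) : f (val y) \in val (s ord_max).
  apply: mem_set; apply: DQ; first exact: set_valP.
  by rewrite -(perm_mem sQ); apply/mapP; exists ord_max; rewrite ?mem_enum.
pose x (y : D) : F (s ord_max) := SigSub (xP y).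
have tP (y : D) : \row_i (w (val (s i)) (val y) / wsum (val y)) \in std_simplex R n.
  apply/mem_set; split=> [i|].
    by rewrite mxE divr_ge0 ?(cw_ge0 wP)// ltW// wsum_gt0.
  under eq_bigr do rewrite mxE.
  have Dy : D (val y) by exact: set_valP.
  rewrite -mulr_suml -[X in _ / X](@sum_off_zero Q S)//.
  - rewrite -(perm_big _ sQ) big_map big_enum/= divff// gt_eqF//.
    have := wsum_gt0 (val y); rewrite /wsum -(@sum_off_zero Q S)//.
    + by rewrite -(perm_big _ sQ) big_map big_enum.
    + by move=> A; exact: DQ0.
    + by move=> A; exact: (cw_out wP).
  - by move=> A; exact: DQ0.
  - by move=> A; exact: (cw_out wP).
pose t (y : D) : std_simplex R n := SigSub (tP y).
exists (fun y => cell (x y) (t y)); split=> [|y|A y].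
- have cx : continuous x.
    apply: (@continuous_subtype D X (val (s ord_max)) x).
    exact: (continuous_comp_fun (@continuous_val T D) cf).
  have ct : continuous t.
    apply: continuous_subtype; apply: mx_continuous => k i.
    under [X in continuous X]eq_fun do rewrite /= mxE.
    apply: (@div_continuous2 R D (fun y => w (val (s i)) (val y)) (fun y => wsum (val y))).
    + exact: continuous_comp_fun (@continuous_val _ _) (cw_cts wP _).
    + exact: continuous_comp_fun (@continuous_val _ _) wsum_continuous.
    + by move=> y; rewrite gt_eqF ?wsum_gt0.
  exact: continuous_comp_fun (continuous_pair cx ct) (@cell_continuous R X U n s).
- exact: cell_space.
- rewrite baryE.
  rewrite (@weights_integ n s (t y) (fun A => w A (val y) / wsum (val y)) Q)//.
    move=> B BQ; rewrite (DQ0 _ _ _ BQ) ?mul0r//; exact: set_valP.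
  by move=> i; rewrite /t /= mxE.
Qed.

Definition positive y := [seq A <- S | w A y != 0].

Lemma positiveP y A : (A \in positive y) = (w A y != 0).
Proof.
rewrite mem_filter; apply: andb_idr; apply: contraNT => /(cw_out wP) ->.
by rewrite eqxx.
Qed.

Lemma positive_gt0 y : (0 < size (positive y))%N.
Proof.
have [A Ay] := cw_neq0 wP (I : setT y).
by have := positiveP y A; rewrite Ay; case: positive.
Qed.

Lemma positive_mem y A : A \in positive y -> U A.
Proof. by rewrite mem_filter => /andP[_]; exact: (cw_mem wP). Qed.

Lemma positive_chain y : {in positive y &, forall A B, A `<=` B \/ B `<=` A}.
Proof. by move=> A B; rewrite !positiveP; exact: (cw_chain wP). Qed.

Lemma chain_weights_point y : continuous f -> exists e,
  hocolim_to_space U R e = f y /\ forall A, bary A e = w A y / wsum y.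
Proof.
move=> cf.
have [|||g [_ gf gw]] := @chart [set y] (positive y) _ (positive_gt0 y) (@positive_mem y)
  (@positive_chain y) _ _ cf.
- by rewrite filter_uniq.
- by move=> _ A -> ; rewrite positiveP negbK => /eqP.
- by move=> _ A ->; rewrite positiveP => Ay; apply: (cw_supp wP) => //; exact: sub_supp.
pose y' : [set y] := SigSub (mem_set (erefl y)).
by exists (g y'); split=> [|A]; [exact: gf|exact: gw].
Qed.

(** The space is cut into finitely many strata according to which weights are nonzero. On the
    closure of a stratum a single chart works: zero weights stay zero by continuity, and [cw_supp]
    keeps [f y] in the sets of the others. By [hocolim_ext] the chart agrees with [G], and the
    closed pieces are pasted. *)
Lemma chain_weights_continuous (G : T -> E) : continuous f ->
  (forall y, hocolim_to_space U R (G y) = f y) ->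
  (forall A y, bary A (G y) = w A y / wsum y) -> continuous G.
Proof.
move=> cf Gf Gw.
pose J y : {set 'I_(size S)} := [set i | w (tnth (in_tuple S) i) y != 0]%SET.
pose D (I : {set 'I_(size S)}) := closure [set y | J y = I].
apply: (@closed_cover_continuous _ _ _ D).
- by move=> I; exact: closed_closure.
- by move=> y; exists (J y); apply: subset_closure.
move=> I; have [[y0 Jy0]|nI] := pselect (exists y, J y = I); last first.
  have nDI z : ~ D I z.
    rewrite /D (_ : [set _ | _] = set0) ?closure0//.
    by apply/seteqP; split=> // y Jy; apply: nI; exists y.
  by move=> y; case: (nDI _ (set_valP y)).
have same y A : J y = I -> (w A y != 0) = (w A y0 != 0).
  move=> JyI; have [AS|AS] := boolP (A \in S); last by rewrite !(cw_out wP)// !eqxx.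
  have [i ->] := tnthP (in_tuple S) _ AS.
  have : (i \in J y) = (i \in J y0) by rewrite JyI Jy0.
  by rewrite !inE.
have [|||g [cg gf gw]] := @chart (D I) (positive y0) _ (positive_gt0 y0) (@positive_mem y0)
  (@positive_chain y0) _ _ cf.
- by rewrite filter_uniq.
- move=> y A Dy; rewrite positiveP negbK => /eqP A0.
  have cA : closed [set y | w A y = 0].
    apply: (@preimage_closed _ _ (w A) [set 0]); last exact: closed_eq.
    by move=> z _; exact: (cw_cts wP).
  have : closure [set y | J y = I] `<=` [set y | w A y = 0].
    apply: (@subset_trans _ (closure [set y | w A y = 0])).
      by apply: closureS => z /= /(same _ A); rewrite A0 eqxx => /negbFE/eqP.
    by rewrite -((closure_id _).1 cA).
  exact.
- move=> y A Dy; rewrite positiveP => A0; apply: (cw_supp wP) => //.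
  by move: y Dy; apply: closureS => y /= /(same _ A) ->.
rewrite (_ : (fun x => _) = g)//; apply/funext => y.
by apply: hocolim_ext => [|A]; rewrite ?Gf ?gf ?Gw ?gw.
Qed.

End charts.
End Hocolim.

(** * Shrinking supports *)

Section curry.
Import ArrowAsCompactOpen.

(* [unit_interval] being compact and regular, taking the product with it
   preserves quotient maps. *)
Lemma quotient_prod_continuous (R : realType) (T : topologicalType)
    (r : T -> T -> Prop) (Z : topologicalType)
    (h : glue_space r * @unit_interval R -> Z) :
  continuous (fun p : T * @unit_interval R => h (\pi_(glue_space r) p.1, p.2)) ->
  continuous h.
Proof.
move=> ch; have [c1 c2] := continuous_curry ch.
have -> : h = uncurry (curry h) by apply/funext => -[].
apply: continuous_uncurry_regular.
- move=> s _; exists setT; first exact: filterT.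
  by split; [exact: compact_unit_interval|exact: closedT].
- exact: uniform_regular.
- apply/(@quotient_continuous T (glue_space r) (@unit_interval R -> Z)).
  exact: c1.
- move=> q; rewrite -[q]reprK; exact: c2.
Qed.

End curry.

Section Shrink.
Context (R : realType) (X : topologicalType) (U : set (set X)).

Local Notation C := (cover_category U).
Local Notation F := (cover_functor U).
Local Notation E := (hocolim F R).
Local Notation I := (@unit_interval R).

Section simplex.
Context (n : nat) (s : cat_string C n).
Implicit Types t : std_simplex R n.

Definition cutoff t A :=
  Num.max 0 (integ s t (ind R A) - integ s t (fun B => integ s t (ind R B)) / 2).

Definition cutmass t := integ s t (cutoff t).

(** Each coordinate is multiplied by the cut-off, not replaced by it: repetitions of a set share its
    new mass in the old proportion, so the resulting measure depends only on the old one. *)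
Definition shrunk t (th : R) i :=
  (1 - th) * val t 0 i + th * (val t 0 i * cutoff t (val (s i)) / cutmass t).

End simplex.

Lemma cutoff_ge0 n s t A : 0 <= @cutoff n s t A.
Proof. by rewrite le_max lexx. Qed.

Lemma cutoff_continuous n s A : continuous (fun t => @cutoff n s t A).
Proof.
apply: max_continuous2; first exact: const_continuous.
apply: sub_continuous2; first exact: integ_continuous.
apply: mul_continuous2; last exact: const_continuous.
exact: sqsum_pre_cts.
Qed.

Lemma cutmass_continuous n s : continuous (@cutmass n s).
Proof.
apply: sum_continuous => i _; apply: mul_continuous2; last exact: cutoff_continuous.
exact: std_simplex_coord.
Qed.

Lemma cutoff_push m n (f : simp_op m n) s t :
  cutoff s (std_simplex_push f t) = cutoff (str_pull f s) t.
Proof. by apply/funext => A; rewrite /cutoff integ_push sqsum_pre_push. Qed.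

Lemma cutmass_push m n (f : simp_op m n) s t :
  cutmass s (std_simplex_push f t) = cutmass (str_pull f s) t.
Proof. by rewrite /cutmass integ_push cutoff_push. Qed.

(** With [x], the coordinates form a point of the homotopy colimit, one of whose coordinates is at
    least the sum of squares [q]. It exceeds the level [q / 2], since [q] is positive. *)
Lemma cutmass_gt0 n (s : cat_string C n) (x : F (s ord_max)) t : 0 < cutmass s t.
Proof.
have [A] := sqsum_le_bary (cell x t); have := sqsum_gt0 (cell x t).
rewrite sqsumE baryE; set q := integ _ _ _ => q0 qA.
have A0 : integ s t (ind R A) != 0 by rewrite gt_eqF// (lt_le_trans q0).
have [i sA ti] := integ_neq0 A0.
have ti0 : 0 < val t 0 i by rewrite lt0r ti simplex_ge0.
rewrite /cutmass /integ (bigD1 i)//= ltr_wpDr//.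
  by rewrite sumr_ge0// => j _; rewrite mulr_ge0 ?simplex_ge0 ?cutoff_ge0.
rewrite mulr_gt0// /cutoff lt_max sA -/q; apply/orP; right; lra.
Qed.

Lemma shrunk_in n (s : cat_string C n) (x : F (s ord_max)) t (th : I) :
  \row_i shrunk s t (val th) i \in std_simplex R n.
Proof.
have m0 := cutmass_gt0 x t.
have := set_valP th; rewrite /unit_interval /= in_itv /= => /andP[th0 th1].
apply/mem_set; split=> [i|].
  rewrite mxE /shrunk addr_ge0// mulr_ge0 ?simplex_ge0 ?subr_ge0//.
  by rewrite divr_ge0 ?mulr_ge0 ?simplex_ge0 ?cutoff_ge0// ltW.
under eq_bigr do rewrite mxE.
rewrite big_split/= -!mulr_sumr -mulr_suml simplex_sum1 -/(cutmass s t).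
rewrite divff ?gt_eqF//.
by rewrite !mulr1 subrK.
Qed.

Definition shrink_cell n (s : cat_string C n) (x : F (s ord_max)) t (th : I) : E :=
  cell x (SigSub (shrunk_in x t th)).

Lemma shrink_cell_space n s x t th :
  hocolim_to_space U R (@shrink_cell n s x t th) = val x.
Proof. exact: cell_space. Qed.

Lemma shrink_cell_bary n s x t th A : bary A (@shrink_cell n s x t th) =
  integ s t (ind R A) * ((1 - val th) + val th * (cutoff s t A / cutmass s t)).
Proof.
rewrite baryE /integ mulr_suml; apply: eq_bigr => i _.
have -> : val (SigSub (shrunk_in x t th)) 0 i = shrunk s t (val th) i by rewrite /= mxE.
rewrite /shrunk /ind; case: eqP => [->|_]; last by rewrite !mulr0 mul0r.
by rewrite !mulr1; ring.
Qed.

Definition shrink (p : E * I) : E :=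
  let: existT n (existT s x, t) := repr p.1 in @shrink_cell n s x t p.2.

(** The new coordinates are computed from the old ones, [sqsum] and the cut mass, all of which are
    functions on the realization; by [hocolim_ext] the chosen representative does not matter. *)
Lemma shrinkE n s x t th : shrink (@cell R X U n s x t, th) = @shrink_cell n s x t th.
Proof.
rewrite /shrink /=; have : \pi_(E) (repr (cell x t)) = cell x t by rewrite reprK.
case: (repr _) => n' [[s' x'] t']; rewrite -/(cell x' t') => e.
have xx' : val x' = val x by rewrite -(cell_space x' t') e cell_space.
have cut_lift : forall A, cutoff s' t' A = cutoff s t A.
  move=> A; rewrite /cutoff -(baryE A x' t') -(sqsumE x' t') e.
  by rewrite baryE sqsumE.
have cutm : cutmass s' t' = cutmass s t.
  pose cm : E -> R := @cell_lift R X U (fun n s t => @cutmass n s t)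
    cutmass_continuous cutmass_push.
  have cmE n1 s1 x1 t1 : cm (@cell R X U n1 s1 x1 t1) = cutmass s1 t1.
    exact: cell_liftE.
  by rewrite -(cmE _ _ x' t') e cmE.
apply: hocolim_ext => [|A]; first by rewrite !shrink_cell_space.
by rewrite !shrink_cell_bary cut_lift cutm -(baryE A x' t') e baryE.
Qed.

Lemma shrink_continuous : continuous shrink.
Proof.
apply: quotient_prod_continuous.
apply: (@sigT_prod_continuous _
  (fun n => (bar F n * std_simplex R n)%type : topologicalType)) => n.
pose h (q : bar F n * (std_simplex R n * I)) : E := shrink (\pi_(E)
  (existT (fun n => bar F n * std_simplex R n)%type n (q.1, q.2.1)), q.2.2).
have ch : continuous h.
  apply: sigT_prod_continuous => s.
  rewrite (_ : (fun p => _) = (fun q : F (s ord_max) * (std_simplex R n * I) =>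
    shrink_cell q.1 q.2.1 q.2.2)); last by apply/funext => q; rewrite -shrinkE.
  pose st (q : F (s ord_max) * (std_simplex R n * I)) : std_simplex R n :=
    SigSub (shrunk_in q.1 q.2.1 q.2.2).
  have cst : continuous st.
    apply: continuous_subtype; apply: mx_continuous => k i.
    under [X in continuous X]eq_fun do rewrite /= mxE.
    pose tq (q : F (s ord_max) * (std_simplex R n * I)) := q.2.1.
    have ctq : continuous tq.
      exact: continuous_comp_fun (@continuous_snd _ _) (@continuous_fst _ _).
    have cth : continuous (fun q : F (s ord_max) * (std_simplex R n * I) => val q.2.2).
      apply: continuous_comp_fun (@continuous_val _ _).
      exact: continuous_comp_fun (@continuous_snd _ _) (@continuous_snd _ _).
    have cti : continuous (fun q => val (tq q) 0 i).
      exact: continuous_comp_fun ctq (@std_simplex_coord _ _ _).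
    apply: add_continuous2; apply: mul_continuous2 => //.
      by apply: sub_continuous2; [exact: const_continuous|exact: cth].
    apply: div_continuous2 => [||q]; last by rewrite gt_eqF// (cutmass_gt0 q.1).
      apply: mul_continuous2 => //.
      exact: continuous_comp_fun ctq (@cutoff_continuous _ _ _).
    exact: continuous_comp_fun ctq (@cutmass_continuous _ _).
  exact: continuous_comp_fun (continuous_pair (@continuous_fst _ _) cst)
    (@cell_continuous R X U n s).
pose a (p : bar F n * std_simplex R n * I) := (p.1.1, (p.1.2, p.2)).
have ca : continuous a.
  apply: (@continuous_pair _ _ _ (fun p : bar F n * std_simplex R n * I => p.1.1)
    (fun p : bar F n * std_simplex R n * I => (p.1.2, p.2))).
    exact: continuous_comp_fun (@continuous_fst _ _) (@continuous_fst _ _).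
  apply: (@continuous_pair _ _ _ (fun p : bar F n * std_simplex R n * I => p.1.2) snd).
    exact: continuous_comp_fun (@continuous_fst _ _) (@continuous_snd _ _).
  exact: continuous_snd.
rewrite (_ : (fun p => _) = fun p => h (a p)); last by apply/funext => -[[]].
exact: (continuous_comp_fun ca ch).
Qed.

Lemma shrink_space p : hocolim_to_space U R (shrink p) = hocolim_to_space U R p.1.
Proof.
case: p => e th; have [n [s [x [t ->]]]] := cellP e.
by rewrite shrinkE shrink_cell_space cell_space.
Qed.

Lemma shrink0 e : shrink (e, I0 R) = e.
Proof.
have [n [s [x [t ->]]]] := cellP e; rewrite shrinkE.
apply: hocolim_ext => [|A]; first by rewrite shrink_cell_space cell_space.
by rewrite shrink_cell_bary baryE /= subr0 mul0r addr0 mulr1.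
Qed.

(** The bound obtained is a closed condition on [e], in contrast to the nonvanishing of a
    coordinate; it is what bounds the closed supports after shrinking. *)
Lemma shrink1_bary e A : bary A (shrink (e, I1 R)) != 0 -> sqsum e / 2 <= bary A e.
Proof.
have [n [s [x [t ->]]]] := cellP e; rewrite shrinkE shrink_cell_bary baryE sqsumE.
rewrite /= subrr add0r mul1r /cutoff leNgt; apply: contraNN => lt.
rewrite (max_idPl _) ?mul0r ?mulr0// ltW//; lra.
Qed.

End Shrink.

(** * Extension of lifts *)

Section Main.
Context (R : realType) (X : topologicalType) (U : set (set X)).

Local Notation C := (cover_category U).
Local Notation F := (cover_functor U).
Local Notation E := (hocolim F R).
Local Notation p := (hocolim_to_space U R).

(** Near a point the few sets in its support carry almost all the mass, so no other set reaches the
    cut-off level; compactness makes finitely many sets suffice globally. *)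
Lemma bary_finite (K : topologicalType) (g : K -> E) :
  compact [set: K] -> continuous g -> exists S : seq (set X),
  [/\ uniq S, {in S, forall A, U A} &
      forall A y, sqsum (g y) / 2 <= bary A (g y) -> A \in S].
Proof.
move=> cK cg.
pose good (S : seq (set X)) :=
  [set y | forall A, sqsum (g y) / 2 <= bary A (g y) -> A \in S].
have cb A : continuous (fun y => bary A (g y)).
  exact: continuous_comp_fun cg (@bary_continuous _ _ _ A).
have near_good y0 : exists S, (good S)° y0.
  have [S [uS S0 S1 _]] := bary_support (g y0); exists S.
  have q0 := sqsum_gt0 (g y0); set q := sqsum (g y0) in q0.
  (* Outside [S] a coordinate is at most the missing mass, below [q / 4], whereas half the sum of
     squares stays above [q / 4] by the next estimate. *)
  have near_sum : \forall y \near y0, 1 - q / 4 < \sum_(A <- S) bary A (g y).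
    have cs : continuous (fun y => \sum_(A <- S) bary A (g y)).
      by apply: sum_continuous => A _; exact: cb.
    apply: (cvgr_gt _ (cs y0)); rewrite S1; lra.
  have near_q : \forall y \near y0, q / 2 < sqsum (g y).
    have cs : continuous (fun y => sqsum (g y)).
      exact: continuous_comp_fun cg (@sqsum_continuous _ _ _).
    apply: (cvgr_gt _ (cs y0)); rewrite -/q; lra.
  rewrite /interior /=; apply: filterS2 near_sum near_q => y sumy qy A Ay.
  apply: contraLR (Ay) => AS; rewrite -ltNge.
  have := @bary_sum_le1 _ _ _ (A :: S) (g y); rewrite /= AS uS big_cons => /(_ isT).
  lra.
(* The filter of all sufficiently large finite lists: compactness with respect to it yields one list
   good for every [y]. *)
pose sup (P : set (seq (set X))) := exists S0 : seq (set X),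
  forall S, {subset S0 <= S} -> P S.
have sup_filter : Filter sup.
  split=> [|P Q [S PS] [S' QS']|P Q PQ [S PS]].
  - by exists [::].
  - exists (S ++ S') => S'' SS''; split; [apply: PS|apply: QS'] => A AS;
      by apply: SS''; rewrite mem_cat AS ?orbT.
  - by exists S => S' /PS /PQ.
have [|D' D'P] := (compact_near_coveringP _).1 cK _ sup
  (fun S y => good S y) sup_filter.
  move=> y _; have [S Sy] := near_good y.
  exists (good S, [set S' : seq (set X) | {subset S <= S'}]) => /=.
    by split=> //; exists S.
  by move=> [y' S'] /= [gy' SS'] A /gy' /SS'.
exists (undup [seq A <- D' | `[< U A >]]); split.
- exact: undup_uniq.
- by move=> A; rewrite mem_undup mem_filter => /andP[/asboolP].
- move=> A y Ay; rewrite mem_undup mem_filter; apply/andP; split.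
    apply/asboolP; suff Ay0 : bary A (g y) != 0 by have [] := bary_mem Ay0.
    by rewrite gt_eqF// (lt_le_trans _ Ay)// divr_gt0// sqsum_gt0.
  by apply: (D'P D' _ y).
Qed.

Lemma bary_sum1 (S : seq (set X)) (e : E) : uniq S ->
  (forall A, A \notin S -> bary A e = 0) -> \sum_(A <- S) bary A e = 1.
Proof.
move=> uS S0; have [S' [uS' S'0 <- _]] := bary_support e.
exact: (@sum_off_zero R X S S' (fun A => bary A e)).
Qed.

Lemma bary_neq0 (e : E) : exists A, bary A e != 0.
Proof.
have [A qA] := sqsum_le_bary e; exists A.
by rewrite gt_eqF// (lt_le_trans _ qA)// sqsum_gt0.
Qed.

Lemma chain_weights_undup (T : topologicalType) (f : T -> X) D S (w : set X -> T -> R) :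
  chain_weights U f D S w -> chain_weights U f D (undup S) w.
Proof.
by case=> ? ? wS SU ? ? ?; split=> // A; rewrite mem_undup; [move=> ?; exact: wS|exact: SU].
Qed.

(* The lift [g] is given on [m <= 1].  It is shrunk where [0 <= m <= 1/2], which
   makes the supports of its barycentric coordinates closed, and then joined
   linearly, for [1/2 <= m <= 1], to weights [r] subordinate to it. *)
Lemma extend_lift (K : topologicalType) (f : K -> X) (m : K -> R) (g : K -> E) :
  liftable R U K -> continuous f -> continuous m ->
  continuous (fun y : [set y | m y <= 1] => g (val y)) ->
  (forall y, m y <= 1 -> p (g y) = f y) ->
  exists G : K -> E, [/\ continuous G, forall y, p (G y) = f y &
    forall y, m y <= 0 -> G y = g y].
Proof.
move=> [cK lK] cf cm cg pg.
pose B := [set y | m y <= 1].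
have cB : closed B := closed_preimage cm (@closed_le R 1).
have cptB : compact [set: B].
  by apply: compact_set_type; exact: subclosed_compact cB cK _.
have [S [uS SU Sg]] := bary_finite cptB cg.
pose big A := [set y : B | sqsum (g (val y)) / 2 <= bary A (g (val y))].
have cbig A : closed (big A).
  rewrite (_ : big A = (fun y : B => bary A (g (val y)) - sqsum (g (val y)) / 2) @^-1`
      [set x | 0 <= x]).
    apply: closed_preimage; last exact: closed_ge.
    apply: sub_continuous2; first exact: continuous_comp_fun cg (@bary_continuous _ _ _ A).
    apply: mul_continuous2; last exact: const_continuous.
    exact: continuous_comp_fun cg (@sqsum_continuous _ _ _).
  by apply/seteqP; split=> y /=; rewrite /big /= subr_ge0.
have bary_big A (y : B) : big A y -> A (f (val y)).
  move=> Ay; rewrite -pg; last exact: (set_valP y).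
  have [|//] := @bary_mem R X U A (g (val y)).
  by rewrite gt_eqF// (lt_le_trans _ Ay)// divr_gt0// sqsum_gt0.
(* These constraints force [r] below every set that the fully shrunk lift can use at a point of the
   collar. *)
pose L := [seq (A, (fun y : B => val y) @` big A) | A <- S].
have fL : constraints U f L.
  move=> V D /mapP[A AS [-> ->]]; split; first exact: SU.
    exact: closed_image_val.
  by move=> _ [y Ay <-]; exact: bary_big.
have [S1 [r [/chain_weights_undup rP rL]]] := lK f cf L fL.
set S1' := undup S1 in rP; have uS1 : uniq S1' by exact: undup_uniq.
pose sg y := shrink (g y, I1 R).
have sgS A (y : B) : bary A (sg (val y)) != 0 -> big A y by move=> /shrink1_bary.
pose D1 := [set y | 2^-1 <= m y <= 1].
have D1B (y : D1) : val y \in B by apply/mem_set; have /andP[] := set_valP y.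
pose i1 (y : D1) : B := SigSub (D1B y).
have ci1 : continuous i1 by apply: continuous_subtype; exact: continuous_val.
pose tot y := wsum S1' r y.
have tot0 y : 0 < tot y := wsum_gt0 uS1 rP y.
(* A convex combination on [D1]: the shrunk lift at [m y = 1/2], the normalized [r] at [m y = 1]. *)
pose v A (y : K) := (2 - 2 * m y) * bary A (sg y) + (2 * m y - 1) * (r A y / tot y).
have v_neq0 A (y : K) : v A y != 0 -> bary A (sg y) != 0 \/ r A y != 0.
  apply: contra_neqP => /not_orP[/negP/negPn/eqP A0 /negP/negPn/eqP A1].
  by rewrite /v A0 A1 mul0r !mulr0 addr0.
pose w A (y : D1) := v A (val y).
pose S2 := undup (S ++ S1').
have uS2 : uniq S2 by exact: undup_uniq.
have mixA A B' (y : D1) : bary A (sg (val y)) != 0 -> r B' (val y) != 0 -> B' `<=` A.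
  move=> /(sgS A (i1 y)) Ay B'y.
  apply: (rL B' A ((fun y : B => val y) @` big A) (val y)) => //.
  - by apply/mapP; exists A => //; exact: (Sg A (i1 y)).
  - by exists (i1 y).
  - exact: sub_supp.
have m1 (y : D1) : 0 <= 2 - 2 * m (val y) /\ 0 <= 2 * m (val y) - 1.
  by have /andP[] := set_valP y; split; lra.
have sgS2 A (y : D1) : A \notin S -> bary A (sg (val y)) = 0.
  by move=> AS; apply/eqP; apply: contraNT AS => /(sgS A (i1 y)); exact: Sg.
have wP : chain_weights U (fun y : D1 => f (val y)) setT S2 w.
  split.
  - move=> A.
    have cmv : continuous (fun y : D1 => m (val y)).
      exact: continuous_comp_fun (@continuous_val _ D1) cm.
    have csg : continuous (fun y : D1 => sg (val y)).
      have cgi := continuous_comp_fun ci1 cg.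
      apply: (continuous_comp_fun _ (@shrink_continuous R X U)).
      by apply: (continuous_pair cgi); exact: cst_continuous.
    apply: add_continuous2; apply: mul_continuous2.
    + apply: sub_continuous2; first exact: const_continuous.
      by apply: mul_continuous2 => //; exact: const_continuous.
    + exact: continuous_comp_fun csg (@bary_continuous _ _ _ A).
    + apply: sub_continuous2; last exact: const_continuous.
      by apply: mul_continuous2 => //; exact: const_continuous.
    + apply: div_continuous2 => [||y]; last by rewrite gt_eqF.
        exact: continuous_comp_fun (@continuous_val _ D1) (cw_cts rP A).
      exact: continuous_comp_fun (@continuous_val _ D1) (wsum_continuous rP).
  - move=> A y; have [? ?] := m1 y.
    by rewrite addr_ge0// mulr_ge0 ?bary_ge0 ?divr_ge0 ?(cw_ge0 rP)// ltW.
  - move=> A y; rewrite mem_undup mem_cat negb_or => /andP[AS AS1].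
    by rewrite /w /v sgS2// (cw_out rP)// mul0r !mulr0 addr0.
  - by move=> A; rewrite mem_undup mem_cat => /orP[/SU//|]; exact: (cw_mem rP).
  - move=> A y _ Ay.
    have [/(bary_big A (i1 y))//|] : big A (i1 y) \/ supp (r A) (val y).
      move: y Ay; apply: (@supp_sub R D1 (w A)
          (i1 @^-1` big A `|` (fun y => val y) @^-1` supp (r A))) => [|y].
        apply: closedU; apply: closed_preimage => //; first exact: continuous_val.
        exact: supp_closed.
      by move=> /v_neq0[/(sgS A (i1 y))|/sub_supp]; [left|right].
    exact: (cw_supp rP).
  - move=> A A' y _ /v_neq0[Ay|Ay] /v_neq0[A'y|A'y].
    + exact: bary_chain Ay A'y.
    + by right; exact: mixA Ay A'y.
    + by left; exact: mixA A'y Ay.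
    + exact: (cw_chain rP) Ay A'y.
  - move=> y _; have [m0 m0'] := m1 y.
    have [my|my] := ltP 2^-1 (m (val y)).
      have [A Ay] := cw_neq0 rP (I : setT (val y)); exists A.
      rewrite /w /v gt_eqF// ltr_wpDl ?mulr_ge0 ?bary_ge0// mulr_gt0//; first lra.
      by rewrite divr_gt0// lt0r Ay (cw_ge0 rP).
    have [A Ay] := bary_neq0 (sg (val y)); exists A.
    have t0 : 0 <= r A (val y) / tot (val y) by rewrite divr_ge0 ?(cw_ge0 rP)// ltW.
    have sA : 0 < bary A (sg (val y)) by rewrite lt0r Ay bary_ge0.
    rewrite /w /v gt_eqF// ltr_pwDl//; last exact: mulr_ge0.
    by rewrite mulr_gt0//; lra.
(* Total weight 1 makes [v] the actual barycentric coordinates, so the pieces can be compared with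
   no further normalization. *)
have wtot y : wsum S2 w y = 1.
  have S2r : \sum_(A <- S2) r A (val y) = tot (val y).
    apply: (@sum_off_zero R X S2 S1' (fun A => r A (val y))) => // A;
      last exact: (cw_out rP).
    by rewrite mem_undup mem_cat negb_or => /andP[_]; exact: (cw_out rP).
  rewrite /wsum /w /v big_split -!mulr_sumr -mulr_suml S2r divff ?gt_eqF//.
  rewrite bary_sum1// => [|A]; first by rewrite /=; ring.
  by rewrite mem_undup mem_cat negb_or => /andP[AS _]; exact: sgS2.
(* The three clauses overlap at [m y = 1/2] and [m y = 1]; the existence of [e] includes their
   agreement there, so pasting only requires continuity of each piece. *)
pose spec y e := [/\ p e = f y, m y <= 2^-1 -> e = shrink (g y, to_unit (2 * m y)),
  2^-1 <= m y <= 1 -> forall A, bary A e = v A y &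
  1 <= m y -> forall A, bary A e = r A y / tot y].
have /choice[G GP] : forall y, exists e, spec y e.
  move=> y; have [my|my] := ltP (m y) 2^-1.
    exists (shrink (g y, to_unit (2 * m y))); split=> //.
    - by rewrite shrink_space; apply: pg; lra.
    - by move=> /andP[my' _]; exfalso; lra.
    - by move=> my'; exfalso; lra.
  have [my1|my1] := leP (m y) 1; last first.
    have [e [pe be]] := chain_weights_point uS1 rP y cf.
    by exists e; split=> // [my'|/andP[_ my']]; exfalso; lra.
  have D1y : y \in D1 by apply/mem_set; rewrite /D1/= my.
  have cf1 := continuous_comp_fun (@continuous_val _ D1) cf.
  have [e [pe be]] := chain_weights_point uS2 wP (SigSub D1y) cf1.
  have {}be A : bary A e = v A y by rewrite be wtot divr1.
  exists e; split=> // [my'|my' A].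
    have m2 : m y = 2^-1 by apply/eqP; rewrite eq_le my my'.
    apply: hocolim_ext => [|A]; first by rewrite shrink_space pe; exact/esym/pg.
    rewrite be /v m2 mulfV ?pnatr_eq0// subrr mul0r addr0 to_unit_ge1//.
    by rewrite -natr1 addrK mul1r.
  have m2 : m y = 1 by apply/eqP; rewrite eq_le my1 my'.
  by rewrite be /v m2 mulr1 subrr mul0r add0r -natr1 addrK mul1r.
exists G; split=> [|y|y my]; last 1 first.
(* For [m y <= 0] the clamp puts the shrinking time at 0, so [g] is unchanged. *)
- have [_ Gy _ _] := GP y; rewrite Gy; last by lra.
  by rewrite to_unit_le0 ?shrink0//; lra.
- pose D (i : option bool) := if i is Some b then
    if b then [set y | m y <= 2^-1] else D1 else [set y | 1 <= m y].
  apply: (@closed_cover_continuous _ _ _ D) => [[[]|]|y|[[]|]].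
  + exact: (closed_preimage cm (@closed_le R 2^-1)).
  + rewrite (_ : D _ = m @^-1` [set x | 2^-1 <= x] `&` m @^-1` [set x | x <= 1]).
      exact: closedI (closed_preimage cm (@closed_ge R 2^-1))
        (closed_preimage cm (@closed_le R 1)).
    by apply/seteqP; split=> y /=; [move=> /andP|move=> [? ?]; apply/andP].
  + exact: (closed_preimage cm (@closed_ge R 1)).
  + have [my|my] := leP (m y) 2^-1; first by exists (Some true).
    have [my1|my1] := leP (m y) 1; last by exists None; exact: ltW.
    by exists (Some false) => /=; rewrite /D1 /= my1 ltW.
  + pose D0 := [set y | m y <= 2^-1].
    rewrite (_ : (fun y => _) = (fun y : D0 =>
        shrink (g (val y), to_unit (2 * m (val y))))); last first.
      by apply/funext => y; have [_ Gy _ _] := GP (val y); exact: Gy (set_valP y).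
    have D0B (y : D0) : val y \in B.
      by apply/mem_set; have := set_valP y; rewrite /D0 /B /=; lra.
    have ci0 : continuous (fun y : D0 => SigSub (D0B y) : B).
      by apply: continuous_subtype; exact: continuous_val.
    apply: (continuous_comp_fun _ (@shrink_continuous R X U)).
    apply: (continuous_pair (continuous_comp_fun ci0 cg)).
    apply: (continuous_comp_fun _ (@to_unit_continuous R)).
    apply: mul_continuous2; first exact: const_continuous.
    exact: continuous_comp_fun (@continuous_val _ D0) cm.
  + apply: (@chain_weights_continuous R X U D1 (fun y => f (val y)) S2 w uS2 wP).
    * exact: continuous_comp_fun (@continuous_val _ D1) cf.
    * by move=> y; have [-> _ _ _] := GP (val y).
    * move=> A y; have [_ _ GA _] := GP (val y).
      by have -> := GA (set_valP y) A; rewrite wtot divr1.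
  + pose D2 := [set y | 1 <= m y].
    have rP2 := chain_weights_comp (@continuous_val _ D2) rP.
    apply: (chain_weights_continuous uS1 rP2).
    * exact: continuous_comp_fun (@continuous_val _ D2) cf.
    * by move=> y; have [-> _ _ _] := GP (val y).
    * move=> A y; have [_ _ _ GA] := GP (val y).
      exact: GA (set_valP y) A.
- by have [-> _ _ _] := GP y.
Qed.

End Main.

(** * Homotopy groups *)

Section Cube.
Context (R : realType).
Local Notation I := (@unit_interval R).

(* [stretch] maps [[0, 1/4]] to 0 and [[3/4, 1]] to 1. *)
Definition stretch (x : R) : R := clamp01 (2 * x - 2^-1).

Lemma clamp01_itv (x : R) : 0 <= clamp01 x <= 1.
Proof. by have := clamp01_subproof x; rewrite inE /unit_interval /= in_itv. Qed.

Lemma clamp01_continuous : continuous (@clamp01 R).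
Proof.
by apply: max_continuous2; [|apply: min_continuous2];
  first [exact: const_continuous|exact: (fun x => cvg_id)].
Qed.

Lemma stretch_itv x : 0 <= stretch x <= 1.
Proof. exact: clamp01_itv. Qed.

Lemma stretch_continuous : continuous stretch.
Proof.
apply: (continuous_comp_fun _ clamp01_continuous).
apply: sub_continuous2; last exact: const_continuous.
apply: mul_continuous2; first exact: const_continuous.
exact: (fun x => cvg_id).
Qed.

Lemma stretch0 x : x <= 4^-1 -> stretch x = 0.
Proof.
by move=> x4; rewrite /stretch /clamp01 (max_idPl _)// ge_min; apply/orP; right; lra.
Qed.

Lemma stretch1 x : 1 - x <= 4^-1 -> stretch x = 1.
Proof.
move=> x4; rewrite /stretch /clamp01 (min_idPl _) ?(max_idPr _)//; lra.
Qed.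

Definition edge (x : R) := Num.min x (1 - x).

Lemma edge_continuous : continuous edge.
Proof.
apply: min_continuous2; first exact: (fun x => cvg_id).
apply: sub_continuous2; first exact: const_continuous.
exact: (fun x => cvg_id).
Qed.

Lemma edge_stretch x : edge x <= 4^-1 -> stretch x = 0 \/ stretch x = 1.
Proof. by rewrite ge_min => /orP[/stretch0|/stretch1]; [left|right]. Qed.

Section dim.
Context (n : nat).
Local Notation Q := (@cube R n).

Lemma cube_val_continuous j : continuous (fun t : Q => val t 0 j).
Proof.
exact: continuous_comp_fun (@continuous_val _ _) (@coord_continuous _ _ _ _ _).
Qed.

Lemma cube_itv (t : Q) j : 0 <= val t 0 j <= 1.
Proof. exact: (set_valP t). Qed.

Lemma cube_stretch_in (t : Q) : \row_j stretch (val t 0 j) \in @cube R n.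
Proof. by apply/mem_set => j; rewrite mxE; exact: stretch_itv. Qed.

Definition cube_stretch (t : Q) : Q := SigSub (cube_stretch_in t).

Lemma cube_stretch_continuous : continuous cube_stretch.
Proof.
apply: continuous_subtype; apply: mx_continuous => k j.
under [X in continuous X]eq_fun do rewrite /= mxE.
exact: continuous_comp_fun (@cube_val_continuous j) stretch_continuous.
Qed.

(** The factor 4 matches [stretch]: a value at most 1 puts some coordinate within 1/4 of an end. The
    default 1 never wins in positive dimension, since [edge] is at most 1/2; in dimension 0 it gives
    the value 4, as befits an empty boundary. *)
Definition cube_edge (t : Q) := 4 * \big[Num.min/1]_j edge (val t 0 j).

Lemma cube_edge_continuous : continuous cube_edge.
Proof.
apply: mul_continuous2; first exact: const_continuous.
apply: continuous_big => [|j _].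
  by apply: min_continuous2; [exact: continuous_fst|exact: continuous_snd].
exact: continuous_comp_fun (@cube_val_continuous j) edge_continuous.
Qed.

Lemma cube_edge_stretch t : cube_edge t <= 1 -> cube_boundary (cube_stretch t).
Proof.
move=> t1; have : \big[Num.min/1]_j edge (val t 0 j) <= 4^-1.
  by rewrite /cube_edge in t1; lra.
move=> /bigmin_leP[|[j _ /edge_stretch tj]]; first lra.
by exists j; rewrite /= mxE.
Qed.

Lemma cube_boundary_edge t : cube_boundary t -> cube_edge t <= 0.
Proof.
move=> [j tj]; suff : \big[Num.min/1]_j edge (val t 0 j) <= 0.
  by rewrite /cube_edge; lra.
apply/bigmin_leP; right; exists j => //; rewrite /edge ge_min.
by case: tj => ->; rewrite ?lexx// subrr lexx orbT.
Qed.

Lemma cube_boundary_stretch t : cube_boundary t -> cube_boundary (cube_stretch t).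
Proof.
by move=> /cube_boundary_edge t0; apply: cube_edge_stretch; exact: le_trans t0 ler01.
Qed.

(** The straight-line homotopy works: [stretch] fixes 0 and 1, so boundary points stay in their
    faces, where [a] is constant. *)
Lemma stretch_homotopic (Y : topologicalType) (a : Q -> Y) (y0 : Y) :
  continuous a -> (forall t, cube_boundary t -> a t = y0) ->
  homotopic_rel R (@cube_boundary R n) a (a \o cube_stretch).
Proof.
move=> ca ay0.
have hP (z : Q * I) : \row_j ((1 - val z.2) * val z.1 0 j +
    val z.2 * stretch (val z.1 0 j)) \in Q.
  apply/mem_set => j; rewrite mxE.
  have /andP[? ?] := cube_itv z.1 j; have /andP[? ?] := stretch_itv (val z.1 0 j).
  have := set_valP z.2; rewrite /unit_interval /= in_itv /= => /andP[? ?].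
  apply/andP; split; nra.
pose h (z : Q * I) : Q := SigSub (hP z).
have ch : continuous h.
  apply: continuous_subtype; apply: mx_continuous => k j.
  under [X in continuous X]eq_fun do rewrite /= mxE.
  have c1 : continuous (fun z : Q * I => val z.1 0 j).
    exact: continuous_comp_fun (@continuous_fst _ _) (@cube_val_continuous j).
  have c2 : continuous (fun z : Q * I => val z.2).
    exact: continuous_comp_fun (@continuous_snd _ _) (@continuous_val _ _).
  apply: add_continuous2; apply: mul_continuous2 => //.
    by apply: sub_continuous2; [exact: const_continuous|exact: c2].
  exact: continuous_comp_fun c1 stretch_continuous.
exists (a \o h); split=> [|t|t|t s tb].
- exact: continuous_comp_fun ch ca.
- by congr a; apply/val_inj/rowP => j; rewrite /= mxE subr0 mul1r mul0r addr0.
- by congr a; apply/val_inj/rowP => j; rewrite /= !mxE subrr mul1r mul0r add0r.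
- rewrite (ay0 _ tb) /=; apply: ay0; have [j tj] := tb; exists j; rewrite /= mxE.
  case: tj => ->; [left|right].
    by rewrite stretch0 ?mulr0 ?addr0// invr_ge0.
  by rewrite stretch1 ?subrr ?invr_ge0// !mulr1 subrK.
Qed.

End dim.
End Cube.

Lemma inj_surj_bijective (S T : Type) (h : S -> T) :
  injective h -> (forall y, exists x, h x = y) -> bijective h.
Proof.
move=> hI /choice[k kK]; exists k => // x.
by apply: hI; rewrite kK.
Qed.

Definition pack_continuous {S T : topologicalType} (h : S -> T)
    (ch : continuous h) : continuousType S T :=
  HB.pack h (isContinuous.Build S T h ch).

(** * Lifting of spheroids and homotopies *)

Section Assembly.
Context (R : realType) (X : topologicalType) (U : set (set X)).
Hypothesis hU : complete_open_cover U.

Local Notation E := (hocolim (cover_functor U) R).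
Local Notation p := (hocolim_to_space U R).
Local Notation I := (@unit_interval R).

Lemma hocolim_to_space_surj (x : X) : exists e : E, p e = x.
Proof.
have c0 : (0 : 'rV[R]_0) \in @cube R 0 by apply/mem_set => -[].
have [_ /(_ (cst x) (@cst_continuous _ _ x) [::])] := liftable_cube R hU 0.
case=> [//|S [w [/chain_weights_undup wP _]]].
have [e [pe _]] := chain_weights_point (undup_uniq S) wP (SigSub c0)
  (@cst_continuous _ _ x).
by exists e.
Qed.

(** After stretching, [c] is constant on a collar, and there the constant [e] is a lift to be
    extended. *)
Lemma spheroid_lift n (c : @cube R n -> X) (e : E) : continuous c ->
  (forall t, cube_boundary t -> c t = p e) ->
  exists a : @cube R n -> E, [/\ continuous a,
    forall t, cube_boundary t -> a t = e &
    homotopic_rel R (@cube_boundary R n) (p \o a) c].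
Proof.
move=> cc ce.
have [||y y1|a [ca pa ae]] := @extend_lift R X U (set_type (@cube R n))
  (c \o @cube_stretch R n) (@cube_edge R n) (cst e) (liftable_cube R hU n) _
  (@cube_edge_continuous R n) _ _.
- exact: continuous_comp_fun (@cube_stretch_continuous R n) cc.
- exact: cst_continuous.
- by rewrite /= ce//; exact: cube_edge_stretch.
exists a; split=> // [t /cube_boundary_edge/ae//|].
have -> : p \o a = c \o @cube_stretch R n by apply/funext => t; exact: pa.
exact/homotopic_sym/(stretch_homotopic cc ce).
Qed.

(** Stretching both the cube and the time yields a lift on a collar of the whole boundary: [a] near
    time 0, [b] near time 1, and [e] near the sides. *)
Lemma homotopy_lift n (a b : @cube R n -> E) (e : E) :
  continuous a -> continuous b -> (forall t, cube_boundary t -> a t = e) ->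
  (forall t, cube_boundary t -> b t = e) ->
  homotopic_rel R (@cube_boundary R n) (p \o a) (p \o b) ->
  homotopic_rel R (@cube_boundary R n) a b.
Proof.
move=> ca cb ae be [H [cH H0 H1 HA]].
pose st := @cube_stretch R n.
have cst' : continuous st := @cube_stretch_continuous R n.
apply: homotopic_trans (stretch_homotopic ca ae) _.
apply: homotopic_trans _ (homotopic_sym (stretch_homotopic cb be)).
pose K : topologicalType := (@cube R n * I)%type.
pose f (z : K) := H (st z.1, to_unit (stretch (val z.2))).
pose m (z : K) := Num.min (cube_edge z.1) (4 * edge (val z.2)).
(* Only the collar [m z <= 1] matters. At time 1/2 the time term of [m] is 2, so there the cube
   coordinate is near the boundary and both branches equal [e]. *)
pose g (z : K) := if val z.2 <= 2^-1 then a (st z.1) else b (st z.1).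
have cfst : continuous (fun z : K => st z.1).
  exact: continuous_comp_fun (@continuous_fst _ _) cst'.
have cval : continuous (fun z : K => val z.2).
  exact: continuous_comp_fun (@continuous_snd _ _) (@continuous_val _ _).
have cf : continuous f.
  apply: (continuous_comp_fun _ cH); apply: (continuous_pair cfst).
  apply: (continuous_comp_fun _ (@to_unit_continuous R)).
  exact: continuous_comp_fun cval (@stretch_continuous R).
have cm : continuous m.
  apply: min_continuous2.
    exact: continuous_comp_fun (@continuous_fst _ _) (@cube_edge_continuous R n).
  apply: mul_continuous2; first exact: const_continuous.
  exact: continuous_comp_fun cval (@edge_continuous R).
have pg z : m z <= 1 -> p (g z) = f z.
  case: z => t s; rewrite /m ge_min /= => /orP[/cube_edge_stretch tb|s4].
    rewrite /f /g /= HA//= ae//.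
    by case: ifP => _; rewrite ?ae ?be.
  have /orP[s0|s1] : (val s <= 4^-1) || (1 - val s <= 4^-1).
    have {}s4 : 4 * edge (val s) <= 1 by exact: s4.
    have : edge (val s) <= 4^-1 by rewrite -[leRHS]mul1r ler_pdivlMr// mulrC.
    by rewrite /edge ge_min.
  - rewrite /f /g /= stretch0// to_unit_le0// H0 ifT//.
    by rewrite (le_trans s0)// lef_pV2 ?posrE// ler_nat.
  - rewrite /f /g /= stretch1// to_unit_ge1// H1 ifF//.
    by apply/negP => s2; have {}s2 : val s <= 2^-1 by []; lra.
have cg : continuous (fun z : [set z | m z <= 1] => g (val z)).
  pose D (i : bool) : set [set z | m z <= 1] := if i
    then [set z | val (val z).2 <= 2^-1] else [set z | 2^-1 <= val (val z).2].
  have cval2 : continuous (fun z : [set z | m z <= 1] => val (val z).2).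
    exact: continuous_comp_fun (@continuous_val _ _) cval.
  apply: (@closed_cover_continuous _ _ _ D) => [[]|z|[]].
  - exact: (closed_preimage cval2 (@closed_le R 2^-1)).
  - exact: (closed_preimage cval2 (@closed_ge R 2^-1)).
  - have [z2|/ltW z2] := leP (val (val z).2) 2^-1; first by exists true.
    by exists false.
  - rewrite (_ : (fun z => _) = fun z : D true => a (st (val (val z)).1)).
      apply: (continuous_comp_fun _ ca); apply: (continuous_comp_fun _ cfst).
      exact: continuous_comp_fun (@continuous_val _ _) (@continuous_val _ _).
    by apply/funext => z; rewrite /g ifT//; exact: (set_valP z).
  - rewrite (_ : (fun z => _) = fun z : D false => b (st (val (val z)).1)).
      apply: (continuous_comp_fun _ cb); apply: (continuous_comp_fun _ cfst).
      exact: continuous_comp_fun (@continuous_val _ _) (@continuous_val _ _).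
    apply/funext => z; rewrite /g; case: ifPn => // z2.
    have z2' : val (val (val z)).2 = 2^-1.
      by apply/eqP; rewrite eq_le z2; exact: (set_valP z).
    have := set_valP (val z); rewrite /= /m ge_min => /orP[/cube_edge_stretch zb|].
      by rewrite ae ?be.
    by rewrite z2' /edge (min_idPl _) => [?|]; [exfalso|]; lra.
have [G [cG pG Gg]] := extend_lift (liftable_prod hU (liftable_cube R hU n)) cf cm cg pg.
exists G; split=> [//|t|t|t s tb] /=.
- rewrite Gg /g /= ?ifT// ?invr_ge0// /m ge_min /edge /=; apply/orP; right.
  by rewrite (min_idPl _) ?mulr0// subr0.
- rewrite Gg /g /= ?ifF//; first by apply/negP; lra.
  rewrite /m ge_min /edge /=; apply/orP; right.
  by rewrite subrr (min_idPr _) ?mulr0.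
- rewrite Gg /g /=; last by rewrite /m ge_min cube_boundary_edge.
  have stb := cube_boundary_stretch tb.
  by case: ifP => _; rewrite ?ae ?be.
Qed.

(** The 0-cube is a point with empty boundary, so a path is a homotopy between maps from it, and
    [homotopy_lift] connects two points whose images are connected. *)
Lemma pi0_map_bijective : bijective (@pi0_map R E X p).
Proof.
have c0 : (0 : 'rV[R]_0) \in @cube R 0 by apply/mem_set => -[].
apply: inj_surj_bijective => [c d|y].
  rewrite -[c]reprK -[d]reprK !pi0_mapE => /pi0_eqP[h [ch h0 h1]]; apply/pi0_eqP.
  have nb t : ~ @cube_boundary R 0 t by move=> [[]].
  have [||t /nb//|t /nb//||H [cH H0 H1 _]] :=
    @homotopy_lift 0 (cst (repr c)) (cst (repr d)) (repr c).
  - exact: cst_continuous.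
  - exact: cst_continuous.
  - exists (fun z => h z.2); split=> // [|t s /nb//].
    exact: continuous_comp_fun (@continuous_snd _ _) ch.
  exists (fun s => H (SigSub c0, s)); split; rewrite ?H0 ?H1//.
  apply: (continuous_comp_fun _ cH).
  by apply: continuous_pair; [exact: cst_continuous|move=> s; exact: cvg_id].
have [e pe] := hocolim_to_space_surj (repr y).
by exists (\pi_(pi0 R E) e); rewrite pi0_mapE pe reprK.
Qed.

Lemma pin_map_bijective n (e : E) : bijective (@pin_map R n E X p e).
Proof.
apply: inj_surj_bijective => [c d|y].
  rewrite -[c]reprK -[d]reprK !pin_mapE => /pin_eqP cd; apply/pin_eqP.
  apply: (@homotopy_lift n _ _ e) cd.
  - exact: cts_fun.
  - exact: cts_fun.
  - exact: set_valP (repr c).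
  - exact: set_valP (repr d).
have [||a [ca ae pa]] := @spheroid_lift n (val (repr y)) e.
- exact: cts_fun.
- exact: set_valP (repr y).
have aS : pack_continuous ca \in spheroid e by apply/mem_set.
exists (\pi_(pin R n e) (SigSub aS)); rewrite pin_mapE -[y]reprK.
exact/pin_eqP.
Qed.

End Assembly.

Theorem theorem4p3p2 (R : realType) (X : topologicalType) (U : set (set X))
    (hU : complete_open_cover U) :
  weak_homotopy_equivalence R (hocolim_to_space U R).
Proof.
by split=> [|n x _]; [exact: pi0_map_bijective|exact: pin_map_bijective].
Qed.
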